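(* Let $d\in\mathbb{N}$ and let $D$ be a non-empty subset of $\mathbb{Z}/d\mathbb{Z}$. Let $\alpha\in B_n$ and $\beta\in B_m$ be classical braids. Then $$\mathrm{tr}_{d,D}(\alpha\#\beta)=\mathrm{tr}_{d,D}(\alpha)\,\mathrm{tr}_{d,D}(\beta).$$
   Context: Framed braid group: $\mathcal{F}_n\cong\mathbb{Z}^n\rtimes B_n$ is generated by the braid generators $\sigma_1,\dots,\sigma_{n-1}$ of $B_n$ and framing generators $t_1,\dots,t_n$, with the braid relations, $t_it_j=t_jt_i$ and $t_j\sigma_i=\sigma_it_{s_i(j)}$, $s_i=(i,i+1)$. $\mathcal{F}_{d,n}$ is the quotient by $t_j^d=1$ for all $j$; put $e_i:=\frac1d\sum_{s=1}^{d}t_i^st_{i+1}^{-s}\in\mathbb{C}\mathcal{F}_{d,n}$. Yokonuma--Hecke algebra: for fixed $q\in\mathbb{C}\setminus\{0\}$, $\mathrm{Y}_{d,n}(q)$ is the quotient of $\mathbb{C}\mathcal{F}_{d,n}$ by the ideal generated by $\sigma_i^2-1-(q-q^{-1})e_i\sigma_i$; $g_i$ is the image of $\sigma_i$. There are natural inclusions $\mathrm{Y}_{d,n}(q)\subset\mathrm{Y}_{d,n+1}(q)$. Trace: for indeterminates $z,x_1,\dots,x_{d-1}$, $\mathrm{tr}_d:\bigcup_{n\ge0}\mathrm{Y}_{d,n}(q)\to\mathbb{C}[z,x_1,\dots,x_{d-1}]$ is the unique linear map (Juyumaya) with $\mathrm{tr}_d(ab)=\mathrm{tr}_d(ba)$,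 $\mathrm{tr}_d(1)=1$, $\mathrm{tr}_d(ag_n)=z\,\mathrm{tr}_d(a)$, $\mathrm{tr}_d(at_{n+1}^s)=x_s\,\mathrm{tr}_d(a)$ ($1\le s\le d-1$) for all $n$ and $a,b\in\mathrm{Y}_{d,n}(q)$. Specialized trace: the E-system is the system $E^{(m)}=x_mE$ ($1\le m\le d-1$) over $\mathbb{C}$, where $E^{(m)}=\frac1d\sum_{s=0}^{d-1}x_{m+s}x_{d-s}$, $E=E^{(0)}$, indices mod $d$, $x_0=1$. Its solutions are parametrized (Gérardin) by the non-empty subsets $D\subseteq\mathbb{Z}/d\mathbb{Z}$: the solution $X_D=(\mathrm{x}_1,\dots,\mathrm{x}_{d-1})$ is $\mathrm{x}_k=\frac1{|D|}\sum_{m\in D}\exp(2\pi km\sqrt{-1}/d)$. $\mathrm{tr}_{d,D}:\bigcup_n\mathrm{Y}_{d,n}(q)\to\mathbb{C}[z]$ is $\mathrm{tr}_d$ with $(x_1,\dots,x_{d-1})$ specialized to $X_D$. For a braid $\alpha$, $\mathrm{tr}_{d,D}(\alpha)$ means $\mathrm{tr}_{d,D}$ of its image under $\sigma_i\mapsto g_i$. Connected sum: for $\alpha\in B_n$, $\beta\in B_m$, $\alpha\#\beta:=\alpha^{[0]}\beta^{[n-1]}\in B_{n+m-1}$, where $\alpha^{[0]}$ is the natural image of $\alpha$ in $B_{n+m-1}$ and $\beta^{[n-1]}$ is the image of $\beta$ under $\sigma_i\mapsto\sigma_{n+i-1}$ ($1\le i\le m-1$). *)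

(* Defs.v *)
From HB Require Import structures.
From mathcomp Require Import all_boot all_order all_algebra.
From mathcomp Require Import generic_quotient ring_quotient perm.
From mathcomp Require Import boolp reals trigo.
From mathcomp Require Import complex.
From mathcomp Require Import finmap mpoly.
From mathcomp Require monalg.

Set Implicit Arguments.
Unset Strict Implicit.
Unset Printing Implicit Defensive.

Import GRing.Theory Num.Theory.

Local Open Scope ring_scope.
Local Open Scope quotient_scope.

(* Presented groups: words in the letters x (coded by (x, true)) and x^-1     *)
(* (coded by (x, false)), modulo the congruence generated by the free         *)
(* cancellations and by the relations u = v such that rels u v.               *)
Section PresentedGroup.

Variables (X : choiceType) (rels : seq (X * bool) -> seq (X * bool) -> Prop).
Local Notation word := (seq (X * bool)).

Inductive word_eq : word -> word -> Prop :=
| word_eq_refl u : word_eq u u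
| word_eq_sym u v : word_eq u v -> word_eq v u
| word_eq_trans u v w : word_eq u v -> word_eq v w -> word_eq u w
| word_eq_cat u u' v v' :
    word_eq u u' -> word_eq v v' -> word_eq (u ++ v) (u' ++ v')
| word_eq_cancel x b : word_eq [:: (x, b); (x, ~~ b)] [::]
| word_eq_rel u v : rels u v -> word_eq u v.

Definition word_eqb : rel word := fun u v => `[< word_eq u v >].

Lemma word_eqb_equiv : equiv_class_of word_eqb.
Proof.
split=> [u|u v|v u w]; first exact/asboolP/word_eq_refl.
  by apply/asboolP/asboolP; apply: word_eq_sym.
by move=> /asboolP uv /asboolP vw; apply/asboolP/(word_eq_trans uv vw).
Qed.

Canonical word_equiv := EquivRelPack word_eqb_equiv.
Canonical word_encModRel := defaultEncModRel word_eqb.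

Definition presented := {eq_quot word_eqb}.

HB.instance Definition _ : EqQuotient word word_eqb presented :=
  EqQuotient.on presented.
HB.instance Definition _ := Choice.on presented.

Lemma presentedP u v : \pi_presented u = \pi_presented v <-> word_eq u v.
Proof.
by split=> [/eqmodP /asboolP|uv] //; apply/eqmodP/asboolP.
Qed.

Lemma presentedW (P : presented -> Prop) :
  (forall u, P (\pi_presented u)) -> forall a, P a.
Proof. by move=> Ppi a; rewrite -[a]reprK. Qed.

Definition word_inv (u : word) : word := rev [seq (l.1, ~~ l.2) | l <- u].

Lemma word_eq_invl w : word_eq (word_inv w ++ w) [::].
Proof.
elim: w => [|[x b] w IHw]; first exact: word_eq_refl.
rewrite /word_inv map_cons rev_cons cat_rcons -[_ :: _ :: _]/([:: _; _] ++ w).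
apply: word_eq_trans IHw; apply: word_eq_cat; first exact: word_eq_refl.
rewrite -[X in word_eq _ X]cat0s; apply: word_eq_cat (word_eq_refl _).
by have := word_eq_cancel x (~~ b); rewrite negbK.
Qed.

Lemma word_eq_invr w : word_eq (w ++ word_inv w) [::].
Proof.
have := word_eq_invl (word_inv w); rewrite {1}/word_inv /word_inv map_rev revK.
rewrite -map_comp (eq_map (g := id)) ?map_id // => -[x b] /=.
by rewrite negbK.
Qed.

Lemma word_eq_inv u v : word_eq u v -> word_eq (word_inv u) (word_inv v).
Proof.
move=> uv; rewrite -[word_inv u]cats0.
apply: (word_eq_trans (v := word_inv u ++ (v ++ word_inv v))).
  by apply: word_eq_cat (word_eq_refl _) (word_eq_sym (word_eq_invr v)).
rewrite catA -[X in word_eq _ X]cat0s; apply: word_eq_cat (word_eq_refl _).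
apply: word_eq_trans (word_eq_invl u).
exact: word_eq_cat (word_eq_refl _) (word_eq_sym uv).
Qed.

Definition presented_one : presented := \pi_presented [::].
Definition presented_mul (a b : presented) : presented :=
  \pi_presented (repr a ++ repr b).
Definition presented_inv (a : presented) : presented :=
  \pi_presented (word_inv (repr a)).

Lemma repr_word u : word_eq (repr (\pi_presented u)) u.
Proof. by apply/presentedP; rewrite reprK. Qed.

Lemma pi_mul u v : presented_mul (\pi_presented u) (\pi_presented v) = \pi_presented (u ++ v).
Proof. by apply/presentedP/word_eq_cat; apply: repr_word. Qed.

Lemma pi_inv u : presented_inv (\pi_presented u) = \pi_presented (word_inv u).
Proof. by apply/presentedP/word_eq_inv/repr_word. Qed.

Fact presented_mulA : associative presented_mul.
Proof.
by elim/presentedW=> u; elim/presentedW=> v; elim/presentedW=> w; rewrite !pi_mul catA.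
Qed.

Fact presented_mul1 : left_id presented_one presented_mul.
Proof. by elim/presentedW=> u; rewrite pi_mul. Qed.

Fact presented_mulr1 : right_id presented_one presented_mul.
Proof. by elim/presentedW=> u; rewrite pi_mul cats0. Qed.

Fact presented_mulV : left_inverse presented_one presented_inv presented_mul.
Proof. by elim/presentedW=> u; rewrite pi_inv pi_mul; apply/presentedP/word_eq_invl. Qed.

Fact presented_mulrV : right_inverse presented_one presented_inv presented_mul.
Proof. by elim/presentedW=> u; rewrite pi_inv pi_mul; apply/presentedP/word_eq_invr. Qed.

HB.instance Definition _ := isGroup.Build presented
  presented_mulA presented_mul1 presented_mulr1 presented_mulV presented_mulrV.

Definition gen (x : X) : presented := \pi_presented [:: (x, true)].

Section Lift.

Variables (G : groupType) (f : X -> G).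

Definition word_eval (u : word) : G :=
  foldr (fun l a => (if l.2 then f l.1 else (f l.1)^-1) * a)%g 1%g u.

Lemma word_eval_cat u v :
  word_eval (u ++ v) = (word_eval u * word_eval v)%g.
Proof. by elim: u => [|l u IHu] /=; rewrite ?mul1g // IHu mulgA. Qed.

Hypothesis f_rel : forall u v, rels u v -> word_eval u = word_eval v.

Lemma word_eval_eq u v : word_eq u v -> word_eval u = word_eval v.
Proof.
elim=> {u v} [//|//|u v w _ -> //|u u' v v' _ uu' _ vv'|x b|u v /f_rel //].
  by rewrite !word_eval_cat uu' vv'.
by case: b; rewrite /= mulg1 ?mulgV ?mulVg.
Qed.

Definition presented_lift of (forall u v, rels u v -> word_eval u = word_eval v)
  := fun a : presented => word_eval (repr a).

Local Notation lift := (presented_lift f_rel).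

Lemma lift_pi (u : word) : lift (\pi_presented u) = word_eval u.
Proof. exact/word_eval_eq/repr_word. Qed.

Fact lift_is_morphism : {morph lift : a b / (a / b)%g}.
Proof.
have liftM : {morph lift : a b / (a * b)%g}.
  elim/presentedW=> u; elim/presentedW=> v.
  by rewrite [(_ * _)%g]pi_mul !lift_pi word_eval_cat.
move=> a b; rewrite liftM; congr (_ * _)%g.
apply: (mulIg (lift b)); rewrite -liftM !mulVg.
exact: (lift_pi [::]).
Qed.

HB.instance Definition _ := isGroupMorphism.Build presented G lift
  lift_is_morphism.

Lemma lift_gen x : lift (gen x) = f x.
Proof. by rewrite lift_pi /= mulg1. Qed.

End Lift.

End PresentedGroup.


Section PresentedMap.

Variables (X Y : choiceType).
Variables (relX : seq (X * bool) -> seq (X * bool) -> Prop).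
Variables (relY : seq (Y * bool) -> seq (Y * bool) -> Prop).

Definition word_map (f : X -> Y) (u : seq (X * bool)) : seq (Y * bool) :=
  [seq (f l.1, l.2) | l <- u].

Lemma word_eval_gen f u :
  word_eval (fun x => gen relY (f x)) u = \pi_(presented relY) (word_map f u).
Proof.
elim: u => [//|[x b] u /= ->].
have -> : (if b then gen relY (f x) else (gen relY (f x))^-1)%g
  = \pi_(presented relY) [:: (f x, b)] by case: b => //; apply: pi_inv.
exact: pi_mul.
Qed.

Variable f : X -> Y.

Definition rel_compat :=
  forall u v, relX u v -> word_eq relY (word_map f u) (word_map f v).

Hypothesis f_rel : rel_compat.

Fact presented_map_subproof u v : relX u v ->
  word_eval (fun x => gen relY (f x)) u = word_eval (fun x => gen relY (f x)) v.
Proof. by move=> /f_rel uv; rewrite !word_eval_gen; apply/presentedP. Qed.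

Definition presented_map : presented relX -> presented relY :=
  presented_lift presented_map_subproof.

HB.instance Definition _ := UMagmaMorphism.on presented_map.

Lemma presented_map_gen x : presented_map (gen relX x) = gen relY (f x).
Proof. exact: lift_gen. Qed.

End PresentedMap.

(* The group algebra K[G]: finitely supported functions G -> K, with the      *)
(* bilinear extension of the product of G. (The monoid algebras of monalg     *)
(* exclude groups: a monomType has no nontrivial unit.)                       *)
Section GroupAlgebra.

(* Local, because monalg and mpoly use the same notation for polynomials.     *)
Import monalg.

Variables (K : comNzRingType) (G : groupType).

Definition galg := {malg K[G]}.

HB.instance Definition _ := GRing.Lmodule.on galg.

Definition galgU (g : G) : galg := << g >>.

Section Extension.

Variables (V : lmodType K) (f : G -> V).

Definition galg_ext (a : galg) : V := \sum_(g <- msupp a) mcoeff g a *: f g.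

Lemma galg_ext_wide (a : galg) (s : {fset G}) : (msupp a `<=` s)%fset ->
  galg_ext a = \sum_(g <- s) mcoeff g a *: f g.
Proof.
move=> le_s; rewrite /galg_ext (big_fset_incl _ le_s) // => g _.
by move=> /mcoeff_outdom ->; rewrite scale0r.
Qed.

Fact galg_ext_is_linear : linear galg_ext.
Proof.
move=> c a b; pose s := (msupp a `|` msupp b)%fset.
have les : (msupp (c *: a + b) `<=` s)%fset.
  apply: fsubset_trans (msuppD_le _ _) _.
  by apply: fsetUSS (msuppZ_le _ _) (fsubset_refl _).
rewrite (galg_ext_wide les) (galg_ext_wide (fsubsetUl _ _ : _ `<=` s)%fset).
rewrite (galg_ext_wide (fsubsetUr _ _ : _ `<=` s)%fset) scaler_sumr -big_split.
by apply: eq_bigr => g _; rewrite mcoeffD mcoeffZ scalerDl scalerA.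
Qed.

HB.instance Definition _ :=
  GRing.isLinear.Build K galg V *:%R galg_ext galg_ext_is_linear.

Lemma galg_extU g : galg_ext (galgU g) = f g.
Proof.
by rewrite (galg_ext_wide msuppU_le) big_seq_fset1 mcoeffUU scale1r.
Qed.

End Extension.

Lemma galgE (a : galg) : a = \sum_(g <- msupp a) mcoeff g a *: galgU g.
Proof.
apply/malgP => k; rewrite [in LHS](monalgE a) !raddf_sum.
by apply: eq_bigr => g _; rewrite /= mcoeffZ !mcoeffU mulr_natr.
Qed.

Lemma galg_linear_eq (V : lmodType K) (f h : {linear galg -> V}) :
  (forall g, f (galgU g) = h (galgU g)) -> f =1 h.
Proof.
move=> fh a; rewrite (galgE a) !linear_sum.
by apply: eq_bigr => g _; rewrite !linearZ /= fh.
Qed.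

Lemma galg_ind (P : galg -> Prop) :
  (forall g, P (galgU g)) -> (forall c a b, P a -> P b -> P (c *: a + b)) ->
  P 0 -> forall a, P a.
Proof.
move=> PU PZ P0 a; rewrite (galgE a).
by elim/big_rec: _ => // g b _; apply: PZ.
Qed.

Definition galg_mul (a b : galg) : galg :=
  galg_ext (fun g => galg_ext (fun h => galgU (g * h)%g) b) a.

Lemma galg_mulDZl c a b x :
  galg_mul (c *: a + b) x = c *: galg_mul a x + galg_mul b x.
Proof. by rewrite /galg_mul linearP. Qed.

Lemma galg_mulDZr c a b x :
  galg_mul x (c *: a + b) = c *: galg_mul x a + galg_mul x b.
Proof.
rewrite /galg_mul /galg_ext scaler_sumr -big_split; apply: eq_bigr => g _ /=.
by rewrite -!/(galg_ext _ _) linearP scalerDr !scalerA mulrC.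
Qed.

Lemma galg_mul0l x : galg_mul 0 x = 0.
Proof. by rewrite /galg_mul linear0. Qed.

Lemma galg_mul0r x : galg_mul x 0 = 0.
Proof. by have := galg_mulDZr (-1) 0 0 x; rewrite !scaleN1r oppr0 addr0 addNr. Qed.

Lemma galg_mulU g h : galg_mul (galgU g) (galgU h) = galgU (g * h)%g.
Proof. by rewrite /galg_mul !galg_extU. Qed.

Fact galg_mulA : associative galg_mul.
Proof.
move=> a b c; elim/galg_ind: a => [g|k a a' IHa IHa'|]; first 1 last.
- by rewrite !galg_mulDZl IHa IHa'.
- by rewrite !galg_mul0l.
elim/galg_ind: b => [h|k b b' IHb IHb'|]; first 1 last.
- by rewrite galg_mulDZl !galg_mulDZr galg_mulDZl IHb IHb'.
- by rewrite galg_mul0l galg_mul0r galg_mul0l.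
elim/galg_ind: c => [l|k c c' IHc IHc'|]; first 1 last.
- by rewrite !galg_mulDZr IHc IHc'.
- by rewrite !galg_mul0r.
by rewrite !galg_mulU mulgA.
Qed.

Fact galg_mul1 : left_id (galgU 1%g) galg_mul.
Proof.
elim/galg_ind=> [g|k a a' IHa IHa'|]; last by rewrite galg_mul0r.
  by rewrite galg_mulU mul1g.
by rewrite galg_mulDZr IHa IHa'.
Qed.

Fact galg_mulr1 : right_id (galgU 1%g) galg_mul.
Proof.
elim/galg_ind=> [g|k a a' IHa IHa'|]; last by rewrite galg_mul0l.
  by rewrite galg_mulU mulg1.
by rewrite galg_mulDZl IHa IHa'.
Qed.

Fact galg_mulDl : left_distributive galg_mul +%R.
Proof. by move=> a b c; have := galg_mulDZl 1 a b c; rewrite !scale1r. Qed.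

Fact galg_mulDr : right_distributive galg_mul +%R.
Proof. by move=> a b c; have := galg_mulDZr 1 b c a; rewrite !scale1r. Qed.

Fact galg_one_neq0 : galgU 1%g != 0.
Proof.
apply/eqP => /malgP /(_ 1%g) /eqP; rewrite mcoeffUU mcoeff0.
exact/negP/oner_neq0.
Qed.

HB.instance Definition _ := GRing.Zmodule_isNzRing.Build galg
  galg_mulA galg_mul1 galg_mulr1 galg_mulDl galg_mulDr galg_one_neq0.

Fact galg_scaleAl (c : K) (a b : galg) : c *: (a * b) = (c *: a) * b.
Proof.
by have := galg_mulDZl c a 0 b; rewrite addr0 galg_mul0l addr0.
Qed.

HB.instance Definition _ := GRing.Lmodule_isLalgebra.Build K galg galg_scaleAl.

Fact galg_scaleAr (c : K) (a b : galg) : c *: (a * b) = a * (c *: b).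
Proof.
by have := galg_mulDZr c b 0 a; rewrite addr0 galg_mul0r addr0.
Qed.

HB.instance Definition _ := GRing.Lalgebra_isAlgebra.Build K galg galg_scaleAr.

Lemma galgU1 : galgU 1%g = 1.
Proof. by []. Qed.

Lemma galgUM g h : galgU (g * h)%g = galgU g * galgU h.
Proof. by rewrite [RHS]galg_mulU. Qed.

End GroupAlgebra.

Section GroupAlgebraMap.

Variables (K : comNzRingType) (G H : groupType) (f : UMagmaMorphism.type G H).

Definition galg_map : galg K G -> galg K H := galg_ext (fun g => galgU K (f g)).

HB.instance Definition _ := GRing.Linear.on galg_map.

Lemma galg_mapU g : galg_map (galgU K g) = galgU K (f g).
Proof. exact: galg_extU. Qed.

Lemma galg_mapZ c a : galg_map (c *: a) = c *: galg_map a.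
Proof. exact: linearZ. Qed.

Fact galg_map_is_monoid_morphism : GRing.monoid_morphism galg_map.
Proof.
split=> [|a b]; first by rewrite -galgU1 galg_mapU gmulf1.
elim/galg_ind: a => [g|k a a' IHa IHa'|]; first 1 last.
- by rewrite mulrDl -scalerAl !linearP /= IHa IHa' mulrDl -scalerAl.
- by rewrite mul0r linear0 mul0r.
elim/galg_ind: b => [h|k b b' IHb IHb'|]; first 1 last.
- by rewrite mulrDr -scalerAr !linearP /= IHb IHb' mulrDr -scalerAr.
- by rewrite mulr0 linear0 mulr0.
by rewrite -galgUM !galg_mapU gmulfM galgUM.
Qed.

HB.instance Definition _ := GRing.isMonoidMorphism.Build _ _ galg_map
  galg_map_is_monoid_morphism.

End GroupAlgebraMap.

Section AlgebraQuotient.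

Variables (K : comNzRingType) (A : algType K) (S : A -> Prop).

Inductive ideal_gen : A -> Prop :=
| ideal_gen0 : ideal_gen 0
| ideal_genD a b : ideal_gen a -> ideal_gen b -> ideal_gen (a + b)
| ideal_genM a s b : S s -> ideal_gen (a * s * b).

Definition ideal_pred : {pred A} := fun a => `[< ideal_gen a >].

Lemma ideal_genMl a x : ideal_gen x -> ideal_gen (a * x).
Proof.
elim=> {x} [|x y _ IHx _ IHy|b s c Ss]; first by rewrite mulr0; apply: ideal_gen0.
  by rewrite mulrDr; apply: ideal_genD.
by rewrite !mulrA; constructor.
Qed.

Lemma ideal_genMr a x : ideal_gen x -> ideal_gen (x * a).
Proof.
elim=> {x} [|x y _ IHx _ IHy|b s c Ss]; first by rewrite mul0r; apply: ideal_gen0.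
  by rewrite mulrDl; apply: ideal_genD.
by rewrite -mulrA; constructor.
Qed.

Fact ideal_pred_zmod : zmod_closed ideal_pred.
Proof.
split=> [|a b /asboolP Ia /asboolP Ib]; apply/asboolP; first exact: ideal_gen0.
by apply: ideal_genD => //; rewrite -mulN1r; apply: ideal_genMl.
Qed.

HB.instance Definition _ := GRing.isZmodClosed.Build A ideal_pred
  ideal_pred_zmod.

Definition alg_quot := Quotient.quot ideal_pred.

HB.instance Definition _ := GRing.Zmodule.on alg_quot.
HB.instance Definition _ := Quotient.on alg_quot.

Definition alg_pi : A -> alg_quot := \pi_alg_quot.

Lemma alg_piP a b : alg_pi a = alg_pi b <-> ideal_gen (a - b).
Proof.
split=> [/eqP|ab]; first by rewrite -Quotient.idealrBE => /asboolP.
by apply/eqP; rewrite -Quotient.idealrBE; apply/asboolP.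
Qed.

Lemma alg_quotW (P : alg_quot -> Prop) :
  (forall a, P (alg_pi a)) -> forall x, P x.
Proof. by move=> Ppi x; rewrite -[x]reprK. Qed.

Lemma alg_piK x : alg_pi (repr x) = x.
Proof. exact: reprK. Qed.

Fact alg_pi_is_zmod_morphism : zmod_morphism alg_pi.
Proof. exact: raddfB. Qed.

HB.instance Definition _ := GRing.isZmodMorphism.Build A alg_quot alg_pi
  alg_pi_is_zmod_morphism.

Lemma repr_alg_pi a : ideal_gen (repr (alg_pi a) - a).
Proof. by apply/alg_piP; rewrite alg_piK. Qed.

Definition alg_quot_mul (x y : alg_quot) : alg_quot := alg_pi (repr x * repr y).
Definition alg_quot_scale (c : K) (x : alg_quot) : alg_quot :=
  alg_pi (c *: repr x).

Lemma alg_piM a b : alg_quot_mul (alg_pi a) (alg_pi b) = alg_pi (a * b).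
Proof.
apply/alg_piP; have -> : repr (alg_pi a) * repr (alg_pi b) - a * b =
  (repr (alg_pi a) - a) * repr (alg_pi b) + a * (repr (alg_pi b) - b).
  by rewrite mulrBl mulrBr addrA subrK.
by apply: ideal_genD; [apply: ideal_genMr | apply: ideal_genMl]; apply: repr_alg_pi.
Qed.

Lemma alg_piZ c a : alg_quot_scale c (alg_pi a) = alg_pi (c *: a).
Proof.
by apply/alg_piP; rewrite -scalerBr -mulr_algl; apply/ideal_genMl/repr_alg_pi.
Qed.

Fact alg_quot_mulA : associative alg_quot_mul.
Proof.
elim/alg_quotW=> a; elim/alg_quotW=> b; elim/alg_quotW=> c.
by rewrite !alg_piM mulrA.
Qed.

Fact alg_quot_mul1 : left_id (alg_pi 1) alg_quot_mul.
Proof. by elim/alg_quotW=> a; rewrite alg_piM mul1r. Qed.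

Fact alg_quot_mulr1 : right_id (alg_pi 1) alg_quot_mul.
Proof. by elim/alg_quotW=> a; rewrite alg_piM mulr1. Qed.

Fact alg_quot_mulDl : left_distributive alg_quot_mul +%R.
Proof.
elim/alg_quotW=> a; elim/alg_quotW=> b; elim/alg_quotW=> c.
by rewrite -raddfD !alg_piM -raddfD mulrDl.
Qed.

Fact alg_quot_mulDr : right_distributive alg_quot_mul +%R.
Proof.
elim/alg_quotW=> a; elim/alg_quotW=> b; elim/alg_quotW=> c.
by rewrite -raddfD !alg_piM -raddfD mulrDr.
Qed.

HB.instance Definition _ := GRing.Zmodule_isPzRing.Build alg_quot
  alg_quot_mulA alg_quot_mul1 alg_quot_mulr1 alg_quot_mulDl alg_quot_mulDr.

Fact alg_quot_scaleA c e x :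
  alg_quot_scale c (alg_quot_scale e x) = alg_quot_scale (c * e) x.
Proof. by elim/alg_quotW: x => a; rewrite !alg_piZ scalerA. Qed.

Fact alg_quot_scale1 : left_id 1 alg_quot_scale.
Proof. by elim/alg_quotW=> a; rewrite alg_piZ scale1r. Qed.

Fact alg_quot_scaleDr : right_distributive alg_quot_scale +%R.
Proof.
move=> c; elim/alg_quotW=> a; elim/alg_quotW=> b.
by rewrite -raddfD !alg_piZ -raddfD scalerDr.
Qed.

Fact alg_quot_scaleDl x : {morph alg_quot_scale^~ x : c e / c + e}.
Proof.
by move=> c e; elim/alg_quotW: x => a; rewrite !alg_piZ -raddfD scalerDl.
Qed.

HB.instance Definition _ := GRing.Zmodule_isLmodule.Build K alg_quot
  alg_quot_scaleA alg_quot_scale1 alg_quot_scaleDr alg_quot_scaleDl.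

(* A quotient algebra may be trivial, hence is not declared as an lalgType.   *)
Lemma alg_quot_scaleAl (c : K) (x y : alg_quot) : c *: (x * y) = (c *: x) * y.
Proof.
elim/alg_quotW: x => a; elim/alg_quotW: y => b.
by rewrite [_ *: alg_pi a]alg_piZ ![_ * alg_pi b]alg_piM [LHS]alg_piZ scalerAl.
Qed.

Lemma alg_quot_scaleAr (c : K) (x y : alg_quot) : c *: (x * y) = x * (c *: y).
Proof.
elim/alg_quotW: x => a; elim/alg_quotW: y => b.
by rewrite [_ *: alg_pi b]alg_piZ ![alg_pi a * _]alg_piM [LHS]alg_piZ scalerAr.
Qed.

Fact alg_pi_is_monoid_morphism : GRing.monoid_morphism alg_pi.
Proof. by split=> // a b; rewrite [RHS]alg_piM. Qed.

Fact alg_pi_is_scalable : scalable alg_pi.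
Proof. by move=> c a; rewrite [RHS]alg_piZ. Qed.

HB.instance Definition _ := GRing.isMonoidMorphism.Build A alg_quot alg_pi
  alg_pi_is_monoid_morphism.
HB.instance Definition _ := GRing.isScalable.Build K A alg_quot *:%R alg_pi
  alg_pi_is_scalable.

Lemma alg_pi_rel s : S s -> alg_pi s = 0.
Proof.
move=> Ss; rewrite -(raddf0 alg_pi); apply/alg_piP.
by rewrite subr0 -[s]mulr1 -[s]mul1r; constructor.
Qed.

Section Lift.

Variables (B : pzRingType) (f : {rmorphism A -> B}).
Hypothesis f_rel : forall s, S s -> f s = 0.

Definition alg_quot_lift of (forall s, S s -> f s = 0) :=
  fun x : alg_quot => f (repr x).

Local Notation lift := (alg_quot_lift f_rel).

Lemma ideal_gen_ker x : ideal_gen x -> f x = 0.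
Proof.
elim=> {x} [|x y _ fx _ fy|x s y Ss]; first exact: rmorph0.
  by rewrite rmorphD fx fy addr0.
by rewrite !rmorphM (f_rel Ss) mulr0 mul0r.
Qed.

Lemma alg_quot_lift_pi a : lift (alg_pi a) = f a.
Proof.
apply/eqP; rewrite -subr_eq0 -rmorphB; apply/eqP.
exact/ideal_gen_ker/repr_alg_pi.
Qed.

Fact alg_quot_lift_is_zmod_morphism : zmod_morphism lift.
Proof.
elim/alg_quotW=> a; elim/alg_quotW=> b.
by rewrite -raddfB !alg_quot_lift_pi raddfB.
Qed.

Fact alg_quot_lift_is_monoid_morphism : GRing.monoid_morphism lift.
Proof.
split=> [|]; first by rewrite -(rmorph1 alg_pi) alg_quot_lift_pi rmorph1.
elim/alg_quotW=> a; elim/alg_quotW=> b.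
by rewrite -rmorphM !alg_quot_lift_pi rmorphM.
Qed.

HB.instance Definition _ := GRing.isZmodMorphism.Build alg_quot B lift
  alg_quot_lift_is_zmod_morphism.
HB.instance Definition _ := GRing.isMonoidMorphism.Build alg_quot B lift
  alg_quot_lift_is_monoid_morphism.

End Lift.

End AlgebraQuotient.

(* Strands are numbered from 0: the braid generator indexed by i : 'I_n.-1    *)
(* (sigma_(i+1) in the usual numbering) crosses the strands i and i + 1.      *)
Definition strand_lo n (i : 'I_n.-1) : 'I_n := widen_ord (leq_pred n) i.

Fact strand_hi_subproof n (i : 'I_n.-1) : (i.+1 < n)%N.
Proof. by case: n i => [|n] []. Qed.

Definition strand_hi n (i : 'I_n.-1) : 'I_n := Ordinal (strand_hi_subproof i).

Lemma widen_strand_lo n (i : 'I_n.-1) : widen_ord (leqnSn n) (strand_lo i)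
  = @strand_lo n.+1 (widen_ord (leq_pred n) i).
Proof. exact: val_inj. Qed.

Lemma widen_strand_hi n (i : 'I_n.-1) : widen_ord (leqnSn n) (strand_hi i)
  = @strand_hi n.+1 (widen_ord (leq_pred n) i).
Proof. exact: val_inj. Qed.

Section Braid.

Variable n : nat.

Local Notation s i := (i, true).

Inductive braid_rel : seq ('I_n.-1 * bool) -> seq ('I_n.-1 * bool) -> Prop :=
| braid_rel_far (i j : 'I_n.-1) : (i.+1 < j)%N ->
    braid_rel [:: s i; s j] [:: s j; s i]
| braid_rel_near (i j : 'I_n.-1) : j = i.+1 :> nat ->
    braid_rel [:: s i; s j; s i] [:: s j; s i; s j].

Definition braid : groupType := presented braid_rel.

Definition braid_gen (i : 'I_n.-1) : braid := gen braid_rel i.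

End Braid.

(* The connected sum of braids on n.+1 and m.+1 strands is a braid on         *)
(* (n.+1 + m.+1).-1 = (n + m).+1 strands. Of its n + m generators, the first  *)
(* n come from the left summand, the last m from the right one.               *)
Section ConnectedSum.

Variables n m : nat.

Fact braid_left_subproof :
  rel_compat (@braid_rel n.+1) (@braid_rel (n + m).+1) (lshift m).
Proof. by move=> _ _ [] i j ij; apply: word_eq_rel; constructor. Qed.

Fact braid_right_subproof :
  rel_compat (@braid_rel m.+1) (@braid_rel (n + m).+1) (@rshift n m).
Proof.
by move=> _ _ [] i j ij; apply: word_eq_rel; constructor;
  rewrite /= -addnS ?ltn_add2l ?ij.
Qed.

Definition braid_left : braid n.+1 -> braid (n + m).+1 :=
  presented_map braid_left_subproof.
Definition braid_right : braid m.+1 -> braid (n + m).+1 :=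
  presented_map braid_right_subproof.

HB.instance Definition _ := UMagmaMorphism.on braid_left.
HB.instance Definition _ := UMagmaMorphism.on braid_right.

Definition braid_sum (alpha : braid n.+1) (beta : braid m.+1) :
  braid (n + m).+1 := (braid_left alpha * braid_right beta)%g.

End ConnectedSum.

Section FramedBraid.

Variables d n : nat.

Local Notation s i := (inl i, true).
Local Notation t j := (inr j, true).
Local Notation word := (seq (('I_n.-1 + 'I_n) * bool)).

Inductive framed_braid_rel : word -> word -> Prop :=
| framed_braid_rel_braid u v : braid_rel u v ->
    framed_braid_rel (word_map inl u) (word_map inl v)
| framed_braid_rel_comm i j : framed_braid_rel [:: t i; t j] [:: t j; t i]
| framed_braid_rel_act i j :
    framed_braid_rel [:: t j; s i]
                     [:: s i; t (tperm (strand_lo i) (strand_hi i) j)].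

Definition framed_braid : groupType := presented framed_braid_rel.

(* F_{d,n}, presented by the relations of F_n and t_j^d = 1.                  *)
Inductive mod_framed_braid_rel : word -> word -> Prop :=
| mod_framed_braid_rel_framed u v :
    framed_braid_rel u v -> mod_framed_braid_rel u v
| mod_framed_braid_rel_pow j : mod_framed_braid_rel (nseq d (t j)) [::].

Definition mod_framed_braid : groupType := presented mod_framed_braid_rel.

Definition sigma (i : 'I_n.-1) : mod_framed_braid :=
  gen mod_framed_braid_rel (inl i).
Definition framing (j : 'I_n) : mod_framed_braid :=
  gen mod_framed_braid_rel (inr j).

Fact braid_framed_subproof :
  rel_compat (@braid_rel n) mod_framed_braid_rel inl.
Proof. by move=> u v uv; apply/word_eq_rel; do 2 constructor. Qed.

Definition braid_framed : braid n -> mod_framed_braid :=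
  presented_map braid_framed_subproof.

HB.instance Definition _ := UMagmaMorphism.on braid_framed.

End FramedBraid.

Section FramedBraidInclusion.

Variables d n : nat.

Definition framed_gen_incl (x : 'I_n.-1 + 'I_n) : 'I_n.+1.-1 + 'I_n.+1 :=
  match x with
  | inl i => inl (widen_ord (leq_pred n) i)
  | inr j => inr (widen_ord (leqnSn n) j)
  end.

Fact framed_incl_subproof :
  rel_compat (@mod_framed_braid_rel d n) (@mod_framed_braid_rel d n.+1)
             framed_gen_incl.
Proof.
move=> _ _ [_ _ [_ _ [] i j ij|i j|i j]|j]; apply: word_eq_rel.
- left; exact: (framed_braid_rel_braid (@braid_rel_far n.+1
    (widen_ord (leq_pred n) i) (widen_ord (leq_pred n) j) ij)).
- left; exact: (framed_braid_rel_braid (@braid_rel_near n.+1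
    (widen_ord (leq_pred n) i) (widen_ord (leq_pred n) j) ij)).
- by left; apply: framed_braid_rel_comm.
- left; rewrite /word_map /=.
  have -> : widen_ord (leqnSn n) (tperm (strand_lo i) (strand_hi i) j)
    = tperm (@strand_lo n.+1 (widen_ord (leq_pred n) i))
            (@strand_hi n.+1 (widen_ord (leq_pred n) i))
            (widen_ord (leqnSn n) j).
    have widen_inj : injective (widen_ord (leqnSn n)).
      by move=> a b /(congr1 val) /= ab; apply: val_inj.
    rewrite (inj_tperm _ _ _ widen_inj).
    by rewrite widen_strand_lo widen_strand_hi.
  exact: framed_braid_rel_act.
- by rewrite /word_map map_nseq; right.
Qed.

Definition framed_incl : mod_framed_braid d n -> mod_framed_braid d n.+1 :=
  presented_map framed_incl_subproof.

HB.instance Definition _ := UMagmaMorphism.on framed_incl.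

Lemma framed_incl_sigma i :
  framed_incl (sigma d i) = @sigma d n.+1 (widen_ord (leq_pred n) i).
Proof. exact: presented_map_gen. Qed.

Lemma framed_incl_framing j :
  framed_incl (framing d j) = framing d (widen_ord (leqnSn n) j).
Proof. exact: presented_map_gen. Qed.

End FramedBraidInclusion.

Section YokonumaHecke.

Variables (K : fieldType) (d : nat) (q : K).

Section Def.

Variable n : nat.

Local Notation CF := (galg K (mod_framed_braid d n)).
Local Notation U := (@galgU K (mod_framed_braid d n)).

Definition framing_idem (i : 'I_n.-1) : CF :=
  d%:R^-1 *: \sum_(1 <= s < d.+1)
    U (framing d (strand_lo i) ^+ s * framing d (strand_hi i) ^- s)%g.

Definition yokonuma_hecke_rel (a : CF) : Prop :=
  exists i : 'I_n.-1, a = U (sigma d i) ^+ 2 - 1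
    - (q - q^-1) *: (framing_idem i * U (sigma d i)).

Definition yokonuma_hecke := alg_quot yokonuma_hecke_rel.

HB.instance Definition _ := GRing.PzRing.on yokonuma_hecke.
HB.instance Definition _ := GRing.Lmodule.on yokonuma_hecke.

Definition yh_of_framed (a : mod_framed_braid d n) : yokonuma_hecke :=
  alg_pi yokonuma_hecke_rel (U a).

Definition yh_g (i : 'I_n.-1) : yokonuma_hecke := yh_of_framed (sigma d i).
Definition yh_t (j : 'I_n) : yokonuma_hecke := yh_of_framed (framing d j).

Definition yh_of_braid (a : braid n) : yokonuma_hecke :=
  yh_of_framed (braid_framed d a).

End Def.

Section Inclusion.

Variable n : nat.

Definition yh_pre_incl :
    galg K (mod_framed_braid d n) -> yokonuma_hecke n.+1 :=
  alg_pi (@yokonuma_hecke_rel n.+1) \o galg_map (@framed_incl d n).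

HB.instance Definition _ := GRing.RMorphism.on yh_pre_incl.

Lemma galg_map_framing_idem (i : 'I_n.-1) :
  galg_map (@framed_incl d n) (framing_idem i)
  = @framing_idem n.+1 (widen_ord (leq_pred n) i).
Proof.
rewrite /framing_idem galg_mapZ rmorph_sum /=; congr (_ *: _).
apply: eq_bigr => s _; rewrite galg_mapU /=; apply: f_equal.
rewrite gmulfM gmulfV !gmulfXn /= !framed_incl_framing.
by rewrite widen_strand_lo widen_strand_hi.
Qed.

Fact yh_incl_subproof s : @yokonuma_hecke_rel n s -> yh_pre_incl s = 0.
Proof.
case=> i ->; apply: alg_pi_rel; exists (widen_ord (leq_pred n) i).
rewrite !rmorphB rmorph1 rmorphXn /= galg_mapZ rmorphM /= !galg_mapU /=.
by rewrite framed_incl_sigma galg_map_framing_idem.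
Qed.

Definition yh_incl : yokonuma_hecke n -> yokonuma_hecke n.+1 :=
  alg_quot_lift yh_incl_subproof.

HB.instance Definition _ := GRing.RMorphism.on yh_incl.

Lemma yh_incl_pi a : yh_incl (alg_pi _ a) = alg_pi _ (galg_map (@framed_incl d n) a).
Proof. exact: alg_quot_lift_pi. Qed.

Fact yh_inclZ : scalable yh_incl.
Proof.
move=> c; elim/alg_quotW=> a.
by rewrite -linearZ /= !yh_incl_pi galg_mapZ linearZ.
Qed.

HB.instance Definition _ := GRing.isScalable.Build K
  (yokonuma_hecke n) (yokonuma_hecke n.+1) *:%R yh_incl yh_inclZ.

End Inclusion.

End YokonumaHecke.

(* The variables of {mpoly K[d.-1.+1]} are z (of index ord0) and, for         *)
(* 1 <= s <= d - 1, x_s (of index s).                                         *)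
Definition trace_z (K : fieldType) d : {mpoly K[d.-1.+1]} :=
  'X_ord0.

Definition trace_x (K : fieldType) d (k : 'I_d.-1) : {mpoly K[d.-1.+1]} :=
  'X_(lift ord0 k).

(* A linear map on the union of the algebras Y_{d,n}(q) is a family of linear *)
(* maps compatible with the inclusions. Juyumaya's theorem says that for      *)
(* 0 < d and q != 0 exactly one family tr satisfies juyumaya_trace.           *)
Record juyumaya_trace (K : fieldType) d (q : K)
    (tr : forall n, {linear yokonuma_hecke d q n -> {mpoly K[d.-1.+1]}}) :
    Prop := JuyumayaTrace {
  trace_incl : forall n (a : yokonuma_hecke d q n),
    tr n.+1 (yh_incl a) = tr n a;
  traceC : forall n (a b : yokonuma_hecke d q n), tr n (a * b) = tr n (b * a);
  trace1 : forall n, tr n 1 = 1;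
  trace_g : forall n (a : yokonuma_hecke d q n.+1),
    tr n.+2 (yh_incl a * @yh_g K d q n.+2 ord_max) = trace_z K d * tr n.+1 a;
  trace_t : forall n (a : yokonuma_hecke d q n) (k : 'I_d.-1),
    tr n.+1 (yh_incl a * @yh_t K d q n.+1 ord_max ^+ k.+1)
    = trace_x K k * tr n a
}.

Section SpecializedTrace.

Variables (R : realType) (d : nat) (D : {set 'I_d}).

(* The solution X_D of the E-system: its k-th component is the mean over      *)
(* m in D of exp(2 pi i k m / d).                                             *)
Definition E_solution (k : nat) : R[i] :=
  #|D|%:R^-1 * \sum_(m in D)
    let theta := 2 * pi * (k * m)%:R / d%:R in (cos theta +i* sin theta)%C.

Definition trace_specialize : {mpoly R[i][d.-1.+1]} -> {poly R[i]} :=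
  mmap (@polyC R[i])
    (fun j => if unlift ord0 j is Some k then (E_solution k.+1)%:P else 'X).

Definition specialized_trace (q : R[i])
    (tr : forall n, {linear yokonuma_hecke d q n -> {mpoly R[i][d.-1.+1]}})
    n (a : yokonuma_hecke d q n) : {poly R[i]} :=
  trace_specialize (tr n a).

End SpecializedTrace.

(* Main.v *)
Require Import Defs.
From HB Require Import structures.
From mathcomp Require Import all_boot all_order all_algebra.
From mathcomp Require Import reals complex mpoly.
From mathcomp Require Import generic_quotient perm trigo zify lra.

Set Implicit Arguments.
Unset Strict Implicit.
Unset Printing Implicit Defensive.

Import Order.TTheory GRing.Theory Num.Theory.

Local Open Scope ring_scope.

(** Write the connected sum as a b', with a on the strands 0, ..., n and b' the
    braid b shifted to the strands n, ..., n + m. Closing the strands of b' one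
    by one from the last, the Markov rules should reduce b' to a scalar, which
    has to be the trace of b. The two braids share the strand n, so the danger
    is that closing the other strands leaves an element depending on the framing
    of strand n instead of a scalar. There are two reasons why this does not
    happen.

    First, b' lies in the subalgebra generated by the g_i and the idempotents e_i
    (the algebra of braids and ties). Adding a strand to this subalgebra only
    adds products x h y with x and y on the previous strands and h one of 1, g,
    e, e g, where g and e involve the new strand ([bt_level_span]). This
    normal form is proved like that of the whole Yokonuma-Hecke algebra
    ([yh_level_span]), from the common inductive step [subring_gen_span].

    Second, closing the last strand replaces each h by a scalar: 1, z, E or z,
    where E = 1 / |D|. For g this is the Markov rule, and for e g it follows by
    cyclicity ([mtrace_mul_tie_g]). For e, closing the last strand leaves the
    element p = d^-1 \sum_s x_(-s) t^s in the framing t of the previous strand.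
    For X_D, this is 1 / |D| times the projector on the characters of Z/d that
    belong to D, and the trace only sees these characters: on powers of t, the
    equation tr (c p) = E tr (c) is the E-system ([E_system]), and it extends to
    all c by the normal form of the whole algebra ([mtrace_partial_tie]).

    The induction on the number of strands is [mtrace_mul_shift]. It runs
    over the pairs (b, b') simultaneously, in a product of two algebras, so that
    the scalars extracted from b' and from b are the same. *)

(** * Normal forms in towers of rings *)

Section GeneratedSubrings.

Variable A : pzRingType.
Implicit Types (S H : A -> Prop) (x y : A).

Inductive subring_gen S : A -> Prop :=
| subring_gen_in x : S x -> subring_gen S x
| subring_gen1 : subring_gen S 1
| subring_genB x y : subring_gen S x -> subring_gen S y -> subring_gen S (x - y)
| subring_genM x y : subring_gen S x -> subring_gen S y -> subring_gen S (x * y).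

Lemma subring_gen0 S : subring_gen S 0.
Proof. by rewrite -(subrr 1); apply: subring_genB; apply: subring_gen1. Qed.

Lemma subring_genD S x y :
  subring_gen S x -> subring_gen S y -> subring_gen S (x + y).
Proof.
move=> Sx Sy; rewrite -[y]opprK -[- y]sub0r; apply: subring_genB => //.
exact/subring_genB/Sy/subring_gen0.
Qed.

Lemma subring_genX S x k : subring_gen S x -> subring_gen S (x ^+ k).
Proof.
move=> Sx; elim: k => [|k IHk]; first exact: subring_gen1.
by rewrite exprS; apply: subring_genM.
Qed.

Lemma subring_gen_sum S (I : Type) (r : seq I) (F : I -> A) :
  (forall i, subring_gen S (F i)) -> subring_gen S (\sum_(i <- r) F i).
Proof.
by move=> SF; elim/big_ind: _ => //; [apply: subring_gen0|apply: subring_genD].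
Qed.

Lemma subring_gen_mono S S' :
  (forall x, S x -> subring_gen S' x) ->
  forall x, subring_gen S x -> subring_gen S' x.
Proof.
move=> SS' x; elim=> {x} [x /SS' //||x y _ Sx _ Sy|x y _ Sx _ Sy].
- exact: subring_gen1.
- exact: subring_genB.
- exact: subring_genM.
Qed.

Lemma subring_gen_comm S a :
  (forall x, S x -> GRing.comm x a) ->
  forall x, subring_gen S x -> GRing.comm x a.
Proof.
move=> Sa x; elim=> {x} [x /Sa //||x y _ xa _ ya|x y _ xa _ ya].
- exact/commr_sym/commr1.
- exact/commr_sym/commrB/commr_sym.
- exact/commr_sym/commrM/commr_sym.
Qed.

(** The span of the products x h y with h in H and x, y in the subring generated
    by S: a sub-bimodule, closed under both multiplications by that subring.
    Scalars are elements of S in all applications, so that additive closure is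
    enough. *)
Inductive bimod_span S H : A -> Prop :=
| bimod_span0 : bimod_span S H 0
| bimod_spanD u v : bimod_span S H u -> bimod_span S H v -> bimod_span S H (u + v)
| bimod_span_gen x h y : subring_gen S x -> H h -> subring_gen S y ->
    bimod_span S H (x * h * y).

Lemma bimod_spanMl S H x u :
  subring_gen S x -> bimod_span S H u -> bimod_span S H (x * u).
Proof.
move=> Sx; elim=> {u} [|u v _ Hu _ Hv|y h z Sy Hh Sz].
- by rewrite mulr0; apply: bimod_span0.
- by rewrite mulrDr; apply: bimod_spanD.
by rewrite !mulrA; apply: bimod_span_gen => //; apply: subring_genM.
Qed.

Lemma bimod_spanMr S H x u :
  subring_gen S x -> bimod_span S H u -> bimod_span S H (u * x).
Proof.
move=> Sx; elim=> {u} [|u v _ Hu _ Hv|y h z Sy Hh Sz].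
- by rewrite mul0r; apply: bimod_span0.
- by rewrite mulrDl; apply: bimod_spanD.
by rewrite -mulrA; apply: bimod_span_gen => //; apply: subring_genM.
Qed.

Lemma bimod_spanN S H u : bimod_span S H u -> bimod_span S H (- u).
Proof.
rewrite -mulN1r; apply: bimod_spanMl; rewrite -sub0r.
exact/subring_genB/subring_gen1/subring_gen0.
Qed.

Lemma bimod_span_H S H h : H h -> bimod_span S H h.
Proof.
move=> Hh; rewrite -[h]mulr1 -[h]mul1r.
by apply: bimod_span_gen Hh _; apply: subring_gen1.
Qed.

Lemma bimod_span_sum S H (I : Type) (r : seq I) (F : I -> A) :
  (forall i, bimod_span S H (F i)) -> bimod_span S H (\sum_(i <- r) F i).
Proof.
by move=> SF; elim/big_ind: _ => //; [apply: bimod_span0|apply: bimod_spanD].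
Qed.

(** The inductive step of a Jones-type normal form. In a tower B' <= B <= C, where
    C is generated by B and T, everything in C is a sum of terms x h y with x, y
    in B and a single h in H. Indeed, to absorb a further generator s on the
    right of x h y, one writes y itself in the normal form of the level below,
    y = x' h' y'; the factors x' and y' in B' commute with h and s, so that only
    the short product h h' s has to be brought to normal form. *)
Lemma subring_gen_span S' S T H' H :
  H 1 ->
  (forall x, S' x -> subring_gen S x) ->
  (forall x, subring_gen S x -> bimod_span S' H' x) ->
  (forall x h, S' x -> H h -> GRing.comm x h) ->
  (forall x s, S' x -> T s -> GRing.comm x s) ->
  (forall h h' s, H h -> H' h' -> T s -> bimod_span S H (h * h' * s)) ->
  forall x, subring_gen (fun y => S y \/ T y) x -> bimod_span S H x.
Proof.
move=> H1 S'S decS commH commT step x STx.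
suff spanM u : bimod_span S H u -> bimod_span S H (u * x).
  by rewrite -[x]mul1r; apply/spanM/bimod_span_H.
elim: STx u => {x} [x [Sx|Tx]||x y _ IHx _ IHy|x y _ IHx _ IHy] u Hu.
- exact/bimod_spanMr/Hu/subring_gen_in.
- elim: Hu => {u} [|u v _ Hu _ Hv|a h b Sa Hh Sb].
  + by rewrite mul0r; apply: bimod_span0.
  + by rewrite mulrDl; apply: bimod_spanD.
  rewrite -!mulrA; apply: bimod_spanMl => //.
  elim: {b Sb}(decS _ Sb) => [|v w _ Hv _ Hw|y h' z S'y Hh' S'z].
  + by rewrite mul0r mulr0; apply: bimod_span0.
  + by rewrite mulrDl mulrDr; apply: bimod_spanD.
  have -> : h * (y * h' * z * x) = y * (h * h' * x) * z.
    rewrite !mulrA -(subring_gen_comm (fun c Sc => commH c h Sc Hh) S'y).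
    by rewrite -!mulrA (subring_gen_comm (fun c Sc => commT c x Sc Tx) S'z).
  apply: bimod_spanMr; first exact: subring_gen_mono S'S _ S'z.
  apply: bimod_spanMl; first exact: subring_gen_mono S'S _ S'y.
  exact: step.
- by rewrite mulr1.
- by rewrite mulrBr; apply/bimod_spanD/bimod_spanN; [apply: IHx|apply: IHy].
- by rewrite mulrA; apply/IHy/IHx.
Qed.

End GeneratedSubrings.

(** * Yokonuma-Hecke relations and ties *)

(** For commuting x and y with x ^+ d = y ^+ d = 1 this is the idempotent
    d^-1 \sum_s (x / y) ^+ s, projecting on the common eigenspaces where x and y
    have the same eigenvalue: the two strands carrying the framings x and y are
    tied together. As d.-1 = -1 mod d, the inverse of y is y ^+ d.-1. The
    definition is locked because unification would otherwise see a product. *)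
HB.lock Definition tie (K : fieldType) (A : pzRingType) (sc : K -> A) (d : nat)
    (x y : A) : A :=
  sc d%:R^-1 * \sum_(s < d) x ^+ s * y ^+ (d.-1 * s).

Section Tie.

Variables (K : fieldType) (A : pzRingType) (sc : K -> A) (d : nat).
Hypothesis d_gt0 : (0 < d)%N.
Hypothesis scC : forall c x, GRing.comm (sc c) x.
Hypothesis sc_dV : sc d%:R^-1 * d%:R = 1.
Implicit Types (x y z a : A).

Local Notation tie := (tie sc d).

Lemma tieE x y :
  tie x y = sc d%:R^-1 * \sum_(s < d) x ^+ s * y ^+ (d.-1 * s).
Proof. by rewrite tie.unlock. Qed.

Lemma tie_comm a x y : GRing.comm a x -> GRing.comm a y -> GRing.comm a (tie x y).
Proof.
move=> ax ay; rewrite tieE; apply: commrM; first exact/commr_sym/scC.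
by apply: commr_sum => s _; apply: commrM; apply: commrX.
Qed.

Lemma tie_intertwine h x y x' y' :
  x * h = h * x' -> y * h = h * y' -> tie x y * h = h * tie x' y'.
Proof.
have powI u v k : u * h = h * v -> u ^+ k * h = h * v ^+ k.
  move=> uv; elim: k => [|k IHk]; first by rewrite mul1r mulr1.
  by rewrite !exprSr -mulrA uv mulrA IHk -mulrA.
move=> xx yy; rewrite !tieE -mulrA mulr_suml [RHS]mulrA -(scC _ h) -[RHS]mulrA.
rewrite [h * _]mulr_sumr.
congr (_ * _); apply: eq_bigr => s _.
by rewrite -mulrA (powI _ _ _ yy) mulrA (powI _ _ _ xx) mulrA.
Qed.

Lemma tie_diag x : x ^+ d = 1 -> tie x x = 1.
Proof.
move=> xd; rewrite !tieE (eq_bigr (fun=> 1)) ?sumr_const ?card_ord //.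
by move=> s _; rewrite -exprD -mulSn prednK // exprM xd expr1n.
Qed.

Lemma mul_exp_subst a x y k :
  a * x = a * y -> GRing.comm x y -> a * x ^+ k = a * y ^+ k.
Proof.
move=> axy xy; elim: k => // k IHk.
by rewrite exprSr mulrA IHk -mulrA -(commrX k xy) mulrA axy -mulrA -exprS.
Qed.

Lemma mul_tie_substl a x y z :
  a * x = a * y -> GRing.comm x y -> a * tie x z = a * tie y z.
Proof.
move=> axy xy; rewrite !tieE !mulrA -(scC _ a) -!mulrA; congr (_ * _).
rewrite !mulr_sumr; apply: eq_bigr => s _.
by rewrite !mulrA (mul_exp_subst _ axy).
Qed.

Lemma mul_tie_substr a x y z :
  a * x = a * y -> GRing.comm x y -> GRing.comm z x -> GRing.comm z y ->
  a * tie z x = a * tie z y.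
Proof.
move=> axy xy zx zy; rewrite !tieE !mulrA -(scC _ a) -!mulrA; congr (_ * _).
have zX u k s : GRing.comm z u -> z ^+ s * u ^+ k = u ^+ k * z ^+ s.
  by move=> zu; apply/commrX/commr_sym/commrX/commr_sym.
rewrite !mulr_sumr; apply: eq_bigr => s _.
by rewrite !zX // !mulrA (mul_exp_subst _ axy).
Qed.

(** Multiplying the sum by x / y permutes its terms cyclically: in the telescoping
    form f, the sums over 0 .. d-1 and 1 .. d agree as f d = f 0. *)
Lemma tie_absorb x y : x ^+ d = 1 -> y ^+ d = 1 -> GRing.comm x y ->
  tie x y * x = tie x y * y.
Proof.
move=> xd yd xy; rewrite !tieE -!mulrA !mulr_suml; congr (_ * _).
pose f s := x ^+ s * y ^+ (d.-1 * s) * y.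
rewrite [RHS](_ : _ = \sum_(s < d) f s) //.
rewrite [LHS](_ : _ = \sum_(s < d) f s.+1); last first.
  apply: eq_bigr => s _; rewrite /f mulnS exprSr -!mulrA; congr (_ * _).
  rewrite -(commrX (d.-1 * s) xy); congr (_ * _).
  by rewrite -exprSr -addSn prednK // exprD yd mul1r.
have := big_ord_recl d (fun s => f s) : \sum_(s < d.+1) f s = _.
have := big_ord_recr d (fun s => f s) : \sum_(s < d.+1) f s = _.
move=> -> /=; rewrite /f xd [(d.-1 * d)%N]mulnC exprM yd expr1n muln0 !expr0 addrC.
by move=> /addrI <-.
Qed.

Lemma tie_idem x y : x ^+ d = 1 -> y ^+ d = 1 -> GRing.comm x y ->
  tie x y * tie x y = tie x y.
Proof.
move=> xd yd xy.
by rewrite (mul_tie_substl _ (tie_absorb xd yd xy) xy) tie_diag ?mulr1.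
Qed.

Lemma tie_sym x y : x ^+ d = 1 -> y ^+ d = 1 -> GRing.comm x y ->
  tie x y = tie y x.
Proof.
move=> xd yd xy; have yx := commr_sym xy.
have xy_tie : GRing.comm (tie x y) (tie y x).
  apply: tie_comm; apply/commr_sym/tie_comm => //; exact: commr_refl.
have <- : tie x y * tie y x = tie x y.
  rewrite (mul_tie_substr (tie_absorb xd yd xy) xy) ?tie_diag ?mulr1 //.
rewrite xy_tie (mul_tie_substr (tie_absorb yd xd yx) yx) ?tie_diag ?mulr1 //.
Qed.

(** Ties form an equivalence relation: once x and y are tied, tying z to x or to y
    is the same. *)
Lemma tie_trans x y z : x ^+ d = 1 -> y ^+ d = 1 -> GRing.comm x y ->
  tie x y * tie x z = tie x y * tie y z.
Proof. by move=> xd yd xy; exact: (mul_tie_substl _ (tie_absorb xd yd xy) xy). Qed.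

End Tie.

Section Relations.

Variables (K : fieldType) (d : nat) (delta : K) (A : pzRingType) (sc : K -> A).
Variables (g t : nat -> A).

Local Notation tie := (tie sc d).
Local Notation e i := (tie (t i) (t i.+1)).

Definition swap_strands i j :=
  if j == i then i.+1 else if j == i.+1 then i else j.

(** The relations of the Yokonuma-Hecke algebra on N strands, for arbitrary
    elements of an arbitrary ring, indexed by natural numbers. The scalars are a
    central map sc rather than an algebra structure: this makes the relations
    available in a product of two algebras as well. *)
Record yokonuma_relations (N : nat) : Prop := YokonumaRelations {
  scalar_comm : forall c x, GRing.comm (sc c) x;
  scalar_dV : sc d%:R^-1 * d%:R = 1;
  framing_comm : forall i j, (i < N)%N -> (j < N)%N -> GRing.comm (t i) (t j);
  framing_pow : forall j, (j < N)%N -> t j ^+ d = 1;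
  braid_comm : forall i j, (i.+1 < j)%N -> (j.+1 < N)%N -> GRing.comm (g i) (g j);
  braid_braid : forall i, (i.+2 < N)%N ->
    g i * g i.+1 * g i = g i.+1 * g i * g i.+1;
  framing_braid : forall i j, (i.+1 < N)%N -> (j < N)%N ->
    t j * g i = g i * t (swap_strands i j);
  braid_sqr : forall i, (i.+1 < N)%N -> g i * g i = 1 + sc delta * e i * g i
}.

(** Generators of the subalgebras on the first n strands: of the whole algebra
    (yh), and of its subalgebra of braids and ties (bt), which contains the braids
    but sees the framings only through the ties e_i. *)
Inductive yh_gen (n : nat) : A -> Prop :=
| yh_gen_sc c : yh_gen n (sc c)
| yh_gen_g i : (i.+1 < n)%N -> yh_gen n (g i)
| yh_gen_t j : (j < n)%N -> yh_gen n (t j).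

Inductive bt_gen (n : nat) : A -> Prop :=
| bt_gen_sc c : bt_gen n (sc c)
| bt_gen_g i : (i.+1 < n)%N -> bt_gen n (g i)
| bt_gen_e i : (i.+1 < n)%N -> bt_gen n (e i).

Local Notation yh_level n := (subring_gen (yh_gen n)).
Local Notation bt_level n := (subring_gen (bt_gen n)).

(** The middle factors h that occur in the normal forms x h y when strand n is
    added to strands 0, ..., n - 1. *)
Definition yh_step n x : Prop :=
  (exists k, x = t n ^+ k) \/ (if n is p.+1 then x = g p else False).

Definition bt_step n x : Prop :=
  x = 1 \/ (if n is p.+1 then [\/ x = g p, x = e p | x = e p * g p] else False).

Lemma yh_gen_widen m n x : (m <= n)%N -> yh_gen m x -> yh_gen n x.
Proof.
move=> mn [c|i im|j jm]; constructor; first exact: leq_trans im mn.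
exact: leq_trans jm mn.
Qed.

Lemma yh_level_widen m n x : (m <= n)%N -> yh_level m x -> yh_level n x.
Proof.
by move=> mn; apply: subring_gen_mono => y /(yh_gen_widen mn); apply: subring_gen_in.
Qed.

Lemma bt_gen_widen m n x : (m <= n)%N -> bt_gen m x -> bt_gen n x.
Proof. by move=> mn [c|i im|i im]; constructor; apply: leq_trans im mn. Qed.

Lemma yh_level_sc n c : yh_level n (sc c).
Proof. exact/subring_gen_in/yh_gen_sc. Qed.

Lemma yh_level_t n j : (j < n)%N -> yh_level n (t j).
Proof. by move=> jn; apply/subring_gen_in/yh_gen_t. Qed.

Lemma yh_level_g n i : (i.+1 < n)%N -> yh_level n (g i).
Proof. by move=> jn; apply/subring_gen_in/yh_gen_g. Qed.

Lemma yh_level_tie n i j : (i < n)%N -> (j < n)%N -> yh_level n (tie (t i) (t j)).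
Proof.
move=> ilt jlt; rewrite tieE; apply: subring_genM; first exact: yh_level_sc.
by apply: subring_gen_sum => s; apply: subring_genM; apply/subring_genX/yh_level_t.
Qed.

Lemma bt_level_yh n x : bt_level n x -> yh_level n x.
Proof.
apply: subring_gen_mono => y [c|i ilt|i ilt]; first exact: yh_level_sc.
  exact: yh_level_g.
by apply: yh_level_tie => //; apply: ltnW.
Qed.

Variable N : nat.
Hypothesis d_gt0 : (0 < d)%N.
Hypothesis rel : yokonuma_relations N.

Let scC c x : GRing.comm (sc c) x. Proof. exact: scalar_comm rel c x. Qed.
Let sc_dV := scalar_dV rel.

Lemma framing_braid_lo i : (i.+1 < N)%N -> t i * g i = g i * t i.+1.
Proof.
by move=> iN; rewrite (framing_braid rel) ?(ltnW iN) // /swap_strands eqxx.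
Qed.

Lemma framing_braid_hi i : (i.+1 < N)%N -> t i.+1 * g i = g i * t i.
Proof.
by move=> iN; rewrite (framing_braid rel) // /swap_strands eqxx gtn_eqF.
Qed.

Lemma framing_braid_far i j : (i.+1 < N)%N -> (j < N)%N -> j != i -> j != i.+1 ->
  GRing.comm (t j) (g i).
Proof.
move=> iN jN /negPf ji /negPf ji1.
by rewrite /GRing.comm (framing_braid rel) // /swap_strands ji ji1.
Qed.

Lemma tie_braid i : (i.+1 < N)%N -> GRing.comm (e i) (g i).
Proof.
move=> iN; have iN' := ltnW iN.
rewrite /GRing.comm (tie_intertwine d scC (framing_braid_lo iN) (framing_braid_hi iN)).
congr (_ * _); apply: (tie_sym d_gt0 scC sc_dV); rewrite ?(framing_pow rel) //.
exact: framing_comm rel _ _ iN iN'.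
Qed.

(** The inverse of g_i provided by the quadratic relation. *)
Definition braid_inv i : A := g i - sc delta * e i.

Lemma braid_mulV i : (i.+1 < N)%N -> g i * braid_inv i = 1.
Proof.
move=> iN; rewrite /braid_inv mulrBr (braid_sqr rel) // mulrA -(scC _ (g i)) -!mulrA.
by rewrite (tie_braid iN) addrK.
Qed.

Lemma bt_level_braid_inv n i : (i.+1 < n)%N -> bt_level n (braid_inv i).
Proof.
move=> ilt; apply: subring_genB; first exact/subring_gen_in/bt_gen_g.
by apply: subring_genM; apply: subring_gen_in; constructor.
Qed.

Lemma yh_level_comm n x y :
  (forall c, GRing.comm (sc c) y) ->
  (forall i, (i.+1 < n)%N -> GRing.comm (g i) y) ->
  (forall j, (j < n)%N -> GRing.comm (t j) y) ->
  yh_level n x -> GRing.comm x y.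
Proof.
by move=> scy gy ty; apply: subring_gen_comm => z [c|i /gy //|j /ty //].
Qed.

Lemma yh_level_commt n k x : (n <= k < N)%N -> yh_level n x -> GRing.comm x (t k).
Proof.
move=> /andP[nk kN]; apply: yh_level_comm => [c|i ilt|j jlt]; first exact: scC.
  apply/commr_sym/framing_braid_far; lia.
apply: (framing_comm rel); lia.
Qed.

Lemma yh_level_commg n k x : (n <= k)%N -> (k.+1 < N)%N ->
  yh_level n x -> GRing.comm x (g k).
Proof.
move=> nk kN; apply: yh_level_comm => [c|i ilt|j jlt]; first exact: scC.
  apply: (braid_comm rel); lia.
apply: framing_braid_far; lia.
Qed.

Lemma yh_level_commtie n k x : (n <= k)%N -> (k.+1 < N)%N ->
  yh_level n x -> GRing.comm x (e k).
Proof.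
by move=> nk kN nx; apply: tie_comm => //; apply: yh_level_commt nx; lia.
Qed.


Lemma yh_step_level n x : yh_step n x -> yh_level n.+1 x.
Proof.
case=> [[k ->]|]; first exact/subring_genX/yh_level_t.
by case: n => // n ->; apply: yh_level_g.
Qed.

Lemma yh_step_comm n x h : (n < N)%N -> yh_level n.-1 x -> yh_step n h ->
  GRing.comm x h.
Proof.
move=> nN nx [[k ->]|].
  by apply/commrX/(@yh_level_commt n.-1); rewrite ?leq_pred.
by case: n nN nx => // n nN nx ->; apply: (@yh_level_commg n).
Qed.

Lemma framing_braid_hiX i k : (i.+1 < N)%N -> t i.+1 ^+ k * g i = g i * t i ^+ k.
Proof.
move=> iN; elim: k => [|k IHk]; rewrite ?mul1r ?mulr1 //.
by rewrite !exprSr -mulrA framing_braid_hi // mulrA IHk mulrA.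
Qed.

Lemma framing_braid_loX i k : (i.+1 < N)%N -> t i ^+ k * g i = g i * t i.+1 ^+ k.
Proof.
move=> iN; elim: k => [|k IHk]; rewrite ?mul1r ?mulr1 //.
by rewrite !exprSr -mulrA framing_braid_lo // mulrA IHk mulrA.
Qed.

(** The only case that does not reduce to moving framings through g n is
    g t^k g, where the quadratic relation produces t'^k e g (with t' the framing
    of the new strand); expanding e and moving the powers of t' through g gives
    terms with one g again. *)
Lemma yh_step_span n h h' s : (n.+1 < N)%N ->
  yh_step n.+1 h -> yh_step n h' -> yh_step n.+1 s ->
  bimod_span (yh_gen n.+1) (yh_step n.+1) (h * h' * s).
Proof.
move=> nN Hh Hh' Hs; have h'n := yh_step_level Hh'.
have tn k : yh_level n.+1 (t n ^+ k) by apply/subring_genX/yh_level_t.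
have spanT k : bimod_span (yh_gen n.+1) (yh_step n.+1) (t n.+1 ^+ k).
  by apply: bimod_span_H; left; exists k.
have spanG : bimod_span (yh_gen n.+1) (yh_step n.+1) (g n).
  by apply: bimod_span_H; right.
have h't k : GRing.comm h' (t n.+1 ^+ k).
  by apply/commrX/(@yh_level_commt n.+1); rewrite ?leqnn.
case: Hh => [[k ->]|->]; case: Hs => [[l ->]|->].
- by rewrite -h't -mulrA -exprD; apply: bimod_spanMl.
- rewrite -h't -mulrA framing_braid_hiX //.
  by apply: bimod_spanMl => //; apply: bimod_spanMr.
- rewrite -mulrA h't mulrA -framing_braid_loX // -mulrA.
  by apply: bimod_spanMl => //; apply: bimod_spanMr.
case: Hh' h'n h't => [[k ->] _ _|].
  rewrite -framing_braid_hiX // -mulrA (braid_sqr rel) // mulrDr mulr1.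
  apply: bimod_spanD => //.
  rewrite tieE !mulrA -(scalar_comm rel) -!mulrA; apply: bimod_spanMl.
    exact: yh_level_sc.
  rewrite !mulrA -(scalar_comm rel) -!mulrA; apply: bimod_spanMl.
    exact: yh_level_sc.
  rewrite mulr_suml mulr_sumr; apply: bimod_span_sum => i.
  have -> : t n.+1 ^+ k * (t n ^+ i * t n.+1 ^+ (d.-1 * i) * g n) =
            t n ^+ i * (g n * t n ^+ (k + d.-1 * i)).
    rewrite -framing_braid_hiX // exprD !mulrA; congr (_ * _ * _).
    by apply/commrX/commr_sym/commrX/(framing_comm rel)/nN; apply: ltnW.
  by apply: bimod_spanMl => //; apply: bimod_spanMr.
case: n nN spanT spanG tn => // n nN _ spanG _ -> _ _.
rewrite -(braid_braid rel) //; apply: bimod_spanMr; first exact: yh_level_g.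
by apply: bimod_spanMl => //; apply: yh_level_g.
Qed.

(** Induction on n, through [subring_gen_span] for three consecutive levels:
    generators of a level commute with the generators involving only the strands
    above it. This is the spanning half of Juyumaya's inductive basis. *)
Lemma yh_level_span n x : (n < N)%N -> yh_level n.+1 x ->
  bimod_span (yh_gen n) (yh_step n) x.
Proof.
have genS m y : yh_level m.+1 y ->
    subring_gen (fun z => yh_gen m z \/ yh_step m z) y.
  apply: subring_gen_mono => z Hz; apply: subring_gen_in; case: Hz => [c|i|j].
  - by left; constructor.
  - rewrite ltnS leq_eqVlt => /orP[/eqP im|im]; last by left; constructor.
    by right; right; rewrite -im.
  - rewrite ltnS leq_eqVlt => /orP[/eqP jm|jm]; last by left; constructor.
    by right; left; exists 1%N; rewrite jm expr1.
have step1 m : yh_step m 1 by left; exists 0%N.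
elim: n x => [|n IHn] x nN /genS.
  apply: (@subring_gen_span _ (yh_gen 0) _ _ (eq 1)) => //.
  - by move=> y; apply: subring_gen_in.
  - by move=> y Sy; rewrite -[y]mulr1; apply/bimod_spanMl/bimod_span_H.
  - by move=> y h Sy; apply: yh_step_comm => //; apply: subring_gen_in.
  - by move=> y h Sy; apply: yh_step_comm => //; apply: subring_gen_in.
  move=> h h' s [[k ->]|//] <- [[l ->]|//].
  by rewrite mulr1 -exprD; apply: bimod_span_H; left; exists (k + l)%N.
apply: (@subring_gen_span _ (yh_gen n) _ _ (yh_step n)) => //.
- by move=> y Sy; apply/subring_gen_in/yh_gen_widen/Sy.
- by move=> y; apply: IHn; apply: ltnW.
- by move=> y h Sy; apply: yh_step_comm => //; apply: subring_gen_in.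
- by move=> y h Sy; apply: yh_step_comm => //; apply: subring_gen_in.
- by move=> h h' s; apply: yh_step_span.
Qed.

Definition bt_new n x : Prop := if n is p.+1 then x = g p \/ x = e p else False.

Lemma bt_new_step n x : bt_new n x -> bt_step n x.
Proof. by case: n => // n [] ->; right; [constructor 1|constructor 2]. Qed.

Lemma bt_step_level n x : bt_step n x -> bt_level n.+1 x.
Proof.
case=> [->|]; first exact: subring_gen1.
case: n => // n [] ->; first exact/subring_gen_in/bt_gen_g.
  exact/subring_gen_in/bt_gen_e.
by apply: subring_genM; apply: subring_gen_in; constructor.
Qed.

Lemma bt_step_comm n x h : (n < N)%N -> bt_level n.-1 x -> bt_step n h ->
  GRing.comm x h.
Proof.
move=> nN /bt_level_yh nx [->|]; first exact: commr1.
case: n nN nx => // n nN nx.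
have xg := yh_level_commg (leqnn n) nN nx.
have xe := yh_level_commtie (leqnn n) nN nx.
by case=> -> //; apply: commrM.
Qed.

Lemma tieK i : (i.+1 < N)%N -> e i * e i = e i.
Proof.
move=> iN; have iN' := ltnW iN.
apply: (tie_idem d_gt0 scC sc_dV); rewrite ?(framing_pow rel) //.
exact: (framing_comm rel).
Qed.

Section NextStrand.

Variable n : nat.
Hypothesis nN : (n.+1 < N)%N.

Local Notation span := (bimod_span (bt_gen n.+1) (bt_step n.+1)).

Let bt_sc c : bt_level n.+1 (sc c).
Proof. exact/subring_gen_in/bt_gen_sc. Qed.

Let span1 : span 1. Proof. by apply: bimod_span_H; left. Qed.
Let spang : span (g n).
Proof. by apply: bimod_span_H; right; constructor 1. Qed.
Let spane : span (e n).
Proof. by apply: bimod_span_H; right; constructor 2. Qed.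
Let spaneg : span (e n * g n).
Proof. by apply: bimod_span_H; right; constructor 3. Qed.

Lemma bt_step_mul_new h s : bt_step n.+1 h -> bt_new n.+1 s -> span (h * s).
Proof.
case=> [->|[] ->] [] ->; rewrite ?mul1r //.
- rewrite (braid_sqr rel) // -mulrA.
  by apply: bimod_spanD => //; apply: bimod_spanMl.
- by rewrite -tie_braid.
- by rewrite tieK.
- rewrite -mulrA (braid_sqr rel) // mulrDr mulr1; apply: bimod_spanD => //.
  rewrite !mulrA -(scC _ (e n)) -!mulrA (mulrA (e n)) tieK //.
  exact: bimod_spanMl.
- by rewrite -mulrA -tie_braid // mulrA tieK.
Qed.

End NextStrand.

Section NextTwoStrands.

Variable n : nat.
Hypothesis nN : (n.+2 < N)%N.

Local Notation span := (bimod_span (bt_gen n.+2) (bt_step n.+2)).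
Local Notation a := (g n).
Local Notation b := (g n.+1).
Local Notation e1 := (e n).
Local Notation e2 := (e n.+1).
Local Notation f := (tie (t n) (t n.+2)).

Let n1N : (n.+1 < N)%N. Proof. exact: ltnW. Qed.
Let n0N : (n < N)%N. Proof. exact: ltnW. Qed.
Let tt i j : (i < N)%N -> (j < N)%N -> GRing.comm (t i) (t j).
Proof. exact: (framing_comm rel). Qed.
Let td j : (j < N)%N -> t j ^+ d = 1. Proof. exact: (framing_pow rel). Qed.

Lemma tie_comm2 : GRing.comm e1 e2.
Proof. by apply: (tie_comm d scC); apply/commr_sym/(tie_comm d scC); apply: tt. Qed.

Lemma tie_long_lo : e1 * f = e1 * e2.
Proof. by apply: (tie_trans d_gt0 scC); rewrite ?td //; apply: tt. Qed.

Lemma tie_long_hi : e2 * f = e1 * e2.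
Proof.
rewrite tie_comm2; have tsym := tie_sym d_gt0 scC sc_dV.
rewrite (tsym (t n)) ?td //; last exact: tt.
rewrite (tsym (t n.+1)) ?td //; last exact: tt.
rewrite (tsym (t n)) ?td //; last exact: tt.
by apply: (tie_trans d_gt0 scC); rewrite ?td //; apply: tt.
Qed.

Lemma tie_long_comm : GRing.comm e2 f.
Proof. by apply: (tie_comm d scC); apply/commr_sym/(tie_comm d scC); apply: tt. Qed.

Lemma tie_hi_braid : e2 * a = a * f.
Proof.
apply: (tie_intertwine d scC); first exact: framing_braid_hi.
by apply: framing_braid_far => //; lia.
Qed.

Lemma tie_long_braid_lo : f * a = a * e2.
Proof.
apply: (tie_intertwine d scC); first exact: framing_braid_lo.
by apply: framing_braid_far => //; lia.
Qed.

Lemma tie_long_braid_hi : f * b = b * e1.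
Proof.
apply: (tie_intertwine d scC); last exact: framing_braid_hi.
by apply: framing_braid_far => //; lia.
Qed.

Lemma tie_lo_braid : e1 * b = b * f.
Proof.
apply: (tie_intertwine d scC); last exact: framing_braid_lo.
by apply: framing_braid_far => //; lia.
Qed.

Lemma tie_braid_braid : e2 * a * b = a * b * e1.
Proof. by rewrite tie_hi_braid -!mulrA tie_long_braid_hi. Qed.

(** Puts f in the span: e2 is a middle factor, and the elements that conjugate it
    into f belong to the lower level. *)
Lemma tie_long_conj : f = a * e2 * braid_inv n.
Proof. by rewrite -tie_long_braid_lo -mulrA braid_mulV // mulr1. Qed.

(** All products h h' s of consecutive new generators have a normal form. The
    essential ones are b a b = a b a and
    b e1 b = f b^2 = f + delta e1 e2 b, since f e2 = e1 e2; the others follow by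
    moving ties through braids. *)
Lemma bt_step_span h h' s :
  bt_step n.+2 h -> bt_step n.+1 h' -> bt_new n.+2 s -> span (h * h' * s).
Proof.
have La : bt_level n.+2 a by apply/subring_gen_in/bt_gen_g.
have Le : bt_level n.+2 e1 by apply/subring_gen_in/bt_gen_e.
have Lsc c : bt_level n.+2 (sc c) by apply/subring_gen_in/bt_gen_sc.
have Lf x y z : bt_level n.+2 x -> bt_step n.+2 y -> bt_level n.+2 z ->
    span (x * (y * z)).
  by move=> Lx Hy Lz; rewrite mulrA; apply: bimod_span_gen.
have Hb : bt_step n.+2 b by right; constructor 1.
have He : bt_step n.+2 e2 by right; constructor 2.
have Heb : bt_step n.+2 (e2 * b) by right; constructor 3.
have L1 : bt_level n.+2 1 by apply: subring_gen1.
have LM x y : bt_level n.+2 x -> bt_level n.+2 y -> bt_level n.+2 (x * y).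
  exact: subring_genM.
have Linv : bt_level n.+2 (braid_inv n) by apply: bt_level_braid_inv.
have E21 : e2 * e1 = e1 * e2 by rewrite tie_comm2.
have E2b : e2 * b = b * e2 by apply: tie_braid.
have E2a := tie_hi_braid.
have Fa := tie_long_braid_lo.
have Fb := tie_long_braid_hi.
have E1b := tie_lo_braid.
have EE2 : e2 * e2 = e2 by apply: tieK.
have EF2 := tie_long_hi.
have EF1 := tie_long_lo.
have aba := braid_braid rel nN.
have bb := braid_sqr rel nN.
move=> Hh Hh' Hs; have Ls : span s.
  exact/bimod_span_H/bt_new_step.
have Lh' := bt_step_level Hh'.
case: Hh => [->|]; first by rewrite mul1r; apply: bimod_spanMl.
case: Hh' Lh' => [-> _|Hh' Lh'] Hh.
  by rewrite mulr1; apply: bt_step_mul_new => //; right.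
have Bab : b * (a * b) = a * (b * a) by rewrite !mulrA aba.
have Bae : b * (a * e2) = e1 * (b * a) by rewrite -Fa !mulrA E1b.
have Beb : b * (e1 * b) = f + sc delta * (e1 * (e2 * b)).
  rewrite mulrA -Fb -mulrA bb mulrDr mulr1 -mulrA mulrA -(scC _ f) -mulrA.
  by congr (_ + _ * _); rewrite !mulrA -tie_long_comm EF2.
have Bee : b * (e1 * e2) = e1 * (e2 * b).
  by rewrite mulrA -Fb -mulrA -E2b mulrA -tie_long_comm EF2 mulrA.
have Beab : b * (e1 * a * b) = a * (e2 * b * a).
  by rewrite !mulrA -Fb -mulrA -mulrA Bab !mulrA Fa.
have Beae : b * (e1 * a * e2) = e1 * (e2 * (b * a)).
  by rewrite -mulrA -Fa (mulrA e1) EF1 !mulrA -(mulrA b) Bee !mulrA.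
have Eab : e2 * (a * b) = a * (b * e1) by rewrite mulrA tie_braid_braid mulrA.
have Eae : e2 * (a * e2) = a * e1 * e2.
  by rewrite mulrA E2a -mulrA -tie_long_comm EF2 mulrA.
have Spanf : span f.
  by rewrite tie_long_conj -mulrA; apply: Lf.
have Lee z : e2 * (e1 * z) = e1 * (e2 * z) by rewrite !mulrA E21.
have EK z : e2 * (e2 * z) = e2 * z by rewrite mulrA EE2.
have Eabz z : e2 * (a * (b * z)) = a * (b * (e1 * z)).
  by rewrite !mulrA tie_braid_braid.
have Eaez z : e2 * (a * (e2 * z)) = a * (e1 * (e2 * z)).
  by rewrite (mulrA a) mulrA Eae !mulrA.
(* Order of the cases: h = b, e2, e2 b; then s = b, e2; then h' = a, e1, e1 a. *)
case: Hh => ->; case: Hs => ->; case: Hh' {Lh'} => ->.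
- by rewrite -mulrA Bab; apply: Lf.
- rewrite -mulrA Beb; apply: bimod_spanD => //.
  by apply: bimod_spanMl => //; rewrite -[_ * b]mulr1; apply: Lf.
- by rewrite -mulrA Beab; apply: Lf.
- by rewrite -mulrA Bae; apply: Lf.
- by rewrite -mulrA Bee -[_ * b]mulr1; apply: Lf.
- by rewrite -mulrA Beae (mulrA e2); apply: Lf.
- by rewrite -mulrA Eab; apply: Lf.
- by rewrite -mulrA Lee -[_ * b]mulr1; apply: Lf.
- by rewrite -!mulrA Lee Eab mulrA; apply: Lf => //; apply: LM.
- by rewrite -mulrA Eae -[e2]mulr1; apply: Lf => //; apply: LM.
- by rewrite -mulrA Lee EE2 -[e2]mulr1; apply: Lf.
- rewrite -!mulrA Lee Eae -[e2]mulr1 !mulrA -mulrA; apply: Lf => //.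
  by do 2?apply: subring_genM.
- by rewrite -!mulrA Bab Eabz; apply: Lf => //; apply: LM.
- rewrite -!mulrA Beb mulrDr EF2; apply: bimod_spanD.
    by rewrite -[e2]mulr1; apply: Lf.
  rewrite mulrA -(scC _ e2) -mulrA Lee EK; apply: bimod_spanMl => //.
  by rewrite -[_ * b]mulr1; apply: Lf.
- rewrite -!mulrA (mulrA e1) Beab -(mulrA e2) Eaez (mulrA e2) (mulrA a).
  by apply: Lf => //; apply: LM.
- by rewrite -!mulrA Bae Lee (mulrA e2); apply: Lf.
- by rewrite -!mulrA Bee Lee EK -[_ * b]mulr1; apply: Lf.
- by rewrite -!mulrA (mulrA e1) Beae Lee EK (mulrA e2); apply: Lf.
Qed.

End NextTwoStrands.

(** The analogue for braids and ties of Juyumaya's inductive basis, with the same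
    proof. No framing is needed as a middle factor; this is what makes the trace
    of a braid insensitive to the colour of its first strand. *)
Lemma bt_level_span n x : (n < N)%N -> bt_level n.+1 x ->
  bimod_span (bt_gen n) (bt_step n) x.
Proof.
have genS m y : bt_level m.+1 y ->
    subring_gen (fun z => bt_gen m z \/ bt_new m z) y.
  apply: subring_gen_mono => z Hz; apply: subring_gen_in; case: Hz => [c|i|i].
  - by left; constructor.
  - rewrite ltnS leq_eqVlt => /orP[/eqP im|im]; last by left; constructor.
    by right; rewrite -im; left.
  - rewrite ltnS leq_eqVlt => /orP[/eqP im|im]; last by left; constructor.
    by right; rewrite -im; right.
have step1 m : bt_step m 1 by left.
have comm m y h : (m < N)%N -> bt_gen m.-1 y -> bt_step m h -> GRing.comm y h.
  by move=> mN Sy; apply: bt_step_comm => //; apply: subring_gen_in.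
have trivial_span m y : bt_level m y -> bimod_span (bt_gen m) (eq 1) y.
  by move=> Sy; rewrite -[y]mulr1; apply/bimod_spanMl/bimod_span_H.
elim: n x => [|[|n] IHn] x nN /genS.
- apply: (@subring_gen_span _ (bt_gen 0) _ _ (eq 1)) => //.
  + by move=> y; apply: subring_gen_in.
  + exact: trivial_span.
  + by move=> y h; apply: (comm 0%N).
- apply: (@subring_gen_span _ (bt_gen 0) _ _ (eq 1)) => //.
  + by move=> y Sy; apply/subring_gen_in/bt_gen_widen/Sy.
  + move=> y Sy; apply: trivial_span; move: Sy.
    by apply: subring_gen_mono => z [c|//|//]; apply/subring_gen_in/bt_gen_sc.
  + by move=> y h; apply: (comm 1%N).
  + by move=> y s Sy /bt_new_step; apply: (comm 1%N).
  + by move=> h _ s Hh <-; rewrite mulr1; apply: bt_step_mul_new.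
apply: (@subring_gen_span _ (bt_gen n.+1) _ _ (bt_step n.+1)) => //.
- by move=> y Sy; apply/subring_gen_in/bt_gen_widen/Sy.
- by move=> y; apply: IHn; apply: ltnW.
- by move=> y h Sy; apply: (comm n.+2).
- by move=> y s Sy /bt_new_step; apply: (comm n.+2).
- by move=> h h' s; apply: bt_step_span.
Qed.

End Relations.

(** * Shifts and products of the relations *)

Section ShiftAndProduct.

Variables (K : fieldType) (d : nat) (delta : K).

Lemma yokonuma_relations_shift (A : pzRingType) (sc : K -> A) (g t : nat -> A) k M N :
  (k + M <= N)%N -> yokonuma_relations d delta sc g t N ->
  yokonuma_relations d delta sc (fun i => g (k + i)%N) (fun j => t (k + j)%N) M.
Proof.
move=> kMN rel; split.
- exact: scalar_comm rel.
- exact: scalar_dV rel.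
- by move=> i j iM jM; apply: (framing_comm rel); lia.
- by move=> j jM; apply: (framing_pow rel); lia.
- by move=> i j ij jM; apply: (braid_comm rel); lia.
- by move=> i iM; rewrite addnS; apply: (braid_braid rel); lia.
- move=> i j iM jM; rewrite (framing_braid rel); [|lia|lia].
  congr (_ * t _); rewrite /swap_strands -addnS !eqn_add2l.
  by do 2?case: ifP.
- by move=> i iM; rewrite addnS; apply: (braid_sqr rel); lia.
Qed.

Section Product.

Variables (A B : pzRingType) (scA : K -> A) (scB : K -> B).

Definition pair_fun (I : Type) (f : I -> A) (h : I -> B) (i : I) : (A * B)%type :=
  (f i, h i).

Lemma tie_pair (x x' : A) (y y' : B) :
  tie (pair_fun scA scB) d (x, y) (x', y') = (tie scA d x x', tie scB d y y').
Proof.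
rewrite !tieE; apply: injective_projections => /=.
  rewrite (raddf_sum (@fst A B)) /=; congr (_ * _); apply: eq_bigr => s _ /=.
  by rewrite !(rmorphXn (@fst A B)).
rewrite (raddf_sum (@snd A B)) /=; congr (_ * _); apply: eq_bigr => s _ /=.
by rewrite !(rmorphXn (@snd A B)).
Qed.

Lemma yokonuma_relations_pair (gA tA : nat -> A) (gB tB : nat -> B) N :
  yokonuma_relations d delta scA gA tA N ->
  yokonuma_relations d delta scB gB tB N ->
  yokonuma_relations d delta (pair_fun scA scB) (pair_fun gA gB) (pair_fun tA tB) N.
Proof.
have prodE (x x' : A) (y y' : B) : x = x' -> y = y' -> (x, y) = (x', y').
  by move=> -> ->.
have expE (x : A) (y : B) k : (x, y) ^+ k = (x ^+ k, y ^+ k).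
  by elim: k => // k IHk; rewrite !exprS IHk.
have natE k : k%:R = (k%:R, k%:R) :> (A * B)%type.
  by elim: k => // k IHk; rewrite -!natr1 IHk.
move=> rA rB; split.
- by move=> c [x y]; apply: prodE; [apply: (scalar_comm rA)|apply: (scalar_comm rB)].
- by rewrite natE; apply: prodE; [apply: scalar_dV rA|apply: scalar_dV rB].
- move=> i j iN jN.
  by apply: prodE; [apply: (framing_comm rA)|apply: (framing_comm rB)].
- move=> j jN; rewrite expE.
  by apply: prodE; [apply: (framing_pow rA)|apply: (framing_pow rB)].
- by move=> i j ij jN; apply: prodE; [apply: (braid_comm rA)|apply: (braid_comm rB)].
- by move=> i iN; apply: prodE; [apply: (braid_braid rA)|apply: (braid_braid rB)].
- move=> i j iN jN.
  by apply: prodE; [apply: (framing_braid rA)|apply: (framing_braid rB)].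
- move=> i iN; rewrite tie_pair.
  by apply: prodE; [apply: (braid_sqr rA)|apply: (braid_sqr rB)].
Qed.

End Product.

End ShiftAndProduct.

(** * Markov traces satisfying the E-system *)

Section MarkovTrace.

Variables (K : fieldType) (d : nat) (delta : K) (L : comAlgType K).
Variables (z : L) (xi : nat -> K) (E : K).

(** The Markov rules inside a fixed algebra on N strands: the new generator may
    have any index n, provided that the other factor lives on the strands
    below. Here xi k is the value on the k-th power of a framing. *)
Record markov_trace (A : pzRingType) (sc : K -> A) (g t : nat -> A) (N : nat)
    (T : A -> L) : Prop := MarkovTrace {
  markovD : forall a b, T (a + b) = T a + T b;
  markov_scalar : forall c a, T (sc c * a) = c *: T a;
  markovC : forall a b, T (a * b) = T (b * a);
  markov1 : T 1 = 1;
  markov_g : forall n a, (n.+1 < N)%N -> subring_gen (yh_gen sc g t n.+1) a ->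
    T (a * g n) = z * T a;
  markov_t : forall n k a, (n < N)%N -> subring_gen (yh_gen sc g t n) a ->
    T (a * t n ^+ k) = xi k *: T a
}.

Hypothesis d_gt0 : (0 < d)%N.
Hypothesis dK : d%:R != 0 :> K.
Hypothesis xi_E_system : forall k,
  d%:R^-1 * \sum_(s < d) xi (d.-1 * s) * xi (k + s) = E * xi k.

Section FixedAlgebra.

Variables (A : pzRingType) (sc : K -> A) (g t : nat -> A) (N : nat) (T : A -> L).
Hypothesis rel : yokonuma_relations d delta sc g t N.
Hypothesis trT : markov_trace sc g t N T.

Local Notation level n := (subring_gen (yh_gen sc g t n)).
Let mtraceC := markovC trT.
Let mtraceD := markovD trT.
Let mtrace_mul_g := markov_g trT.
Let mtrace_mul_t := markov_t trT.

Lemma mtrace0 : T 0 = 0.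
Proof. by apply: (addrI (T 0)); rewrite -mtraceD !addr0. Qed.

Lemma mtraceB a b : T (a - b) = T a - T b.
Proof. by apply: (addIr (T b)); rewrite -mtraceD !subrK. Qed.

Lemma mtrace_sum (I : Type) (r : seq I) (F : I -> A) :
  T (\sum_(i <- r) F i) = \sum_(i <- r) T (F i).
Proof. by apply: big_morph; [apply: mtraceD|apply: mtrace0]. Qed.

Lemma mtrace_scalar_mid c a b : T (a * (sc c * b)) = c *: T (a * b).
Proof. by rewrite -(markov_scalar trT) !mulrA (scalar_comm rel). Qed.

Lemma mtrace_yh_step n h : (n < N)%N -> yh_step g t n h ->
  exists l : L, forall x, level n x -> T (x * h) = l * T x.
Proof.
move=> nN [[k ->]|].
  by exists (xi k)%:A => x Sx; rewrite mulr_algl; apply: mtrace_mul_t.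
by case: n nN => // n nN ->; exists z => x; apply: mtrace_mul_g.
Qed.

(** What remains of the tie of strand j with a further strand, when the latter is
    closed by the trace. *)
Definition partial_tie j : A :=
  sc d%:R^-1 * \sum_(s < d) sc (xi (d.-1 * s)) * t j ^+ s.

Lemma mtrace_partial_tieE j (x : A) : T (x * partial_tie j) =
  d%:R^-1 *: \sum_(s < d) xi (d.-1 * s) *: T (x * t j ^+ s).
Proof.
rewrite [LHS]mtrace_scalar_mid; congr (_ *: _).
by rewrite mulr_sumr mtrace_sum; apply: eq_bigr => s _; apply: mtrace_scalar_mid.
Qed.

Lemma level_partial_tie n j : (j < n)%N -> level n (partial_tie j).
Proof.
move=> jn; apply: subring_genM; first exact: yh_level_sc.
apply: subring_gen_sum => s; apply: subring_genM; first exact: yh_level_sc.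
exact/subring_genX/yh_level_t.
Qed.

(** In the normal form x h y of level n + 1 with n > 0, the trace replaces h by the
    same scalar on both sides, since the framing of strand 0 is of lower level.
    This leaves the powers of that framing, on which the assertion is the
    E-system. *)
Lemma mtrace_partial_tie0 n x : (n < N)%N -> level n.+1 x ->
  T (x * partial_tie 0) = E *: T x.
Proof.
elim: n x => [|n IHn] x nN Sx.
  elim: {x Sx}(yh_level_span d_gt0 rel nN Sx) =>
      [|u v _ Hu _ Hv|x h y Sx [[k ->]|//] Sy].
  - by rewrite mul0r mtrace0 scaler0.
  - by rewrite (mtraceD u v) scalerDr -Hu -Hv mulrDl -mtraceD.
  have -> : x * t 0 ^+ k * y = x * y * t 0 ^+ k.
    rewrite -!mulrA; congr (_ * _); apply/commr_sym.
    by apply: subring_gen_comm Sy => v [c|//|//]; apply: (scalar_comm rel).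
  have Sxy : level 0 (x * y) by apply: subring_genM.
  rewrite mtrace_partial_tieE mtrace_mul_t //.
  under eq_bigr do rewrite -mulrA -exprD mtrace_mul_t // scalerA.
  by rewrite -scaler_suml !scalerA xi_E_system.
have nN' := ltnW nN.
elim: {x Sx}(yh_level_span d_gt0 rel nN Sx) => [|u v _ Hu _ Hv|x h y Sx Hh Sy].
- by rewrite mul0r mtrace0 scaler0.
- by rewrite (mtraceD u v) scalerDr -Hu -Hv mulrDl -mtraceD.
have [l Tl] := mtrace_yh_step nN Hh.
have Sp : level n.+1 (partial_tie 0) by apply: level_partial_tie.
rewrite -mulrA mtraceC mulrA Tl; last by do 2?apply: subring_genM.
have -> : T (x * h * y) = l * T (y * x).
  by rewrite mtraceC mulrA Tl //; apply: subring_genM.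
rewrite mtraceC mulrA IHn //; last exact: subring_genM.
by rewrite (mtraceC y) scalerAr.
Qed.

(** The framings of two consecutive strands are conjugate by a braid generator,
    which carries the result for strand 0 to all strands. *)
Lemma mtrace_partial_tie n j x : (n < N)%N -> (j <= n)%N -> level n.+1 x ->
  T (x * partial_tie j) = E *: T x.
Proof.
move=> nN; elim: j x => [|j IHj] x jn Sx; first exact: mtrace_partial_tie0 nN Sx.
have jN : (j.+1 < N)%N by apply: leq_ltn_trans jn nN.
have Sg : level n.+1 (g j) by apply: yh_level_g.
have Sgi : level n.+1 (braid_inv d delta sc g t j).
  by apply: bt_level_yh; apply: bt_level_braid_inv.
have gtg s : t j.+1 ^+ s = g j * t j ^+ s * braid_inv d delta sc g t j.
  by rewrite -(framing_braid_hiX rel) // -mulrA (braid_mulV d_gt0 rel) // mulr1.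
have -> : T (x * partial_tie j.+1) =
    T (braid_inv d delta sc g t j * x * g j * partial_tie j).
  rewrite !mtrace_partial_tieE; congr (_ *: _); apply: eq_bigr => s _.
  by rewrite gtg -!mulrA [in RHS]mtraceC !mulrA.
rewrite IHj ?(ltnW jn) //; last by do 2?apply: subring_genM.
by rewrite -mulrA mtraceC -mulrA (braid_mulV d_gt0 rel) // mulr1.
Qed.

Lemma mtrace_mul_tie n x : (n.+1 < N)%N -> level n.+1 x ->
  T (x * tie sc d (t n) (t n.+1)) = E *: T x.
Proof.
move=> nN Sx; rewrite -(mtrace_partial_tie (ltnW nN) (leqnn n) Sx).
rewrite mtrace_partial_tieE tieE mtrace_scalar_mid.
congr (_ *: _); rewrite mulr_sumr mtrace_sum; apply: eq_bigr => s _ /=.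
rewrite mulrA mtrace_mul_t //; apply: subring_genM => //.
exact/subring_genX/yh_level_t.
Qed.

(** Expanding e g into the terms t^s g t^-s, one closes the last strand and the
    powers of t cancel by cyclicity: the tie costs nothing. *)
Lemma mtrace_mul_tie_g n x : (n.+1 < N)%N -> level n.+1 x ->
  T (x * (tie sc d (t n) (t n.+1) * g n)) = z * T x.
Proof.
move=> nN Sx; rewrite tieE -[_ * _ * g n]mulrA mtrace_scalar_mid.
rewrite mulr_suml mulr_sumr mtrace_sum (eq_bigr (fun=> z * T x)) => [|s _].
  by rewrite sumr_const card_ord -scaler_nat scalerA mulVf // scale1r.
have St k : level n.+1 (t n ^+ k) by apply/subring_genX/yh_level_t.
rewrite -mulrA (framing_braid_hiX rel) // !mulrA mtraceC !mulrA.
rewrite mtrace_mul_g //; last by do 2?apply: subring_genM.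
congr (_ * _); rewrite mtraceC mulrA -exprD -mulSn prednK // exprM.
by rewrite (framing_pow rel) 1?ltnW // expr1n mul1r.
Qed.

End FixedAlgebra.

(** An element b of the product algebra is a pair: an element on M strands
    together with its image under the shift by k strands. Generating such pairs
    by the pairs of corresponding generators dispenses with the construction of
    the shift as a morphism of algebras. *)
Section ShiftedPair.

Variables (A B : pzRingType) (scA : K -> A) (scB : K -> B).
Variables (gA tA : nat -> A) (gB tB : nat -> B) (M N k : nat).
Variables (TA : A -> L) (TB : B -> L).
Hypothesis relA : yokonuma_relations d delta scA gA tA M.
Hypothesis relB : yokonuma_relations d delta scB gB tB N.
Hypothesis trA : markov_trace scA gA tA M TA.
Hypothesis trB : markov_trace scB gB tB N TB.
Hypothesis kMN : (k + M <= N)%N.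

Local Notation psc := (pair_fun scA scB).
Local Notation pg := (pair_fun gA (fun i => gB (k + i)%N)).
Local Notation pt := (pair_fun tA (fun i => tB (k + i)%N)).
Local Notation levelA n := (subring_gen (yh_gen scA gA tA n)).
Local Notation levelB n := (subring_gen (yh_gen scB gB tB n)).

Lemma shifted_pair_relations : yokonuma_relations d delta psc pg pt M.
Proof.
by apply: yokonuma_relations_pair relA _; apply: yokonuma_relations_shift relB.
Qed.

Lemma bt_pair_level n b : subring_gen (bt_gen d psc pg pt n) b ->
  levelA n b.1 /\ levelB (k + n) b.2.
Proof.
elim=> {b} [b [c|i ilt|i ilt]||b b' _ [S1 S2] _ [S1' S2']|b b' _ [S1 S2] _ [S1' S2']].
- by split; apply: yh_level_sc.
- by split; apply: yh_level_g => //; rewrite -addnS ltn_add2l.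
- by rewrite tie_pair; split; apply: yh_level_tie; rewrite ?ltn_add2l ?(ltnW ilt).
- by split; apply: subring_gen1.
- by split; apply: subring_genB.
- by split; apply: subring_genM.
Qed.

(** The scalar l is 1, z, E or z according to the kind of h, whatever the algebra. *)
Lemma mtrace_bt_step n h : (0 < n < M)%N -> bt_step d psc pg pt n h ->
  exists l : L,
    (forall x, levelA n x -> TA (x * h.1) = l * TA x) /\
    (forall x, levelB (k + n) x -> TB (x * h.2) = l * TB x).
Proof.
move=> /andP[n_gt0 nM] [->|].
  by exists 1; split=> x _; rewrite mulr1 mul1r.
case: n n_gt0 nM => // n _ nM.
have kN : ((k + n).+1 < N)%N by lia.
case=> ->; rewrite ?tie_pair /= !addnS.
- by exists z; split=> x; [apply: (markov_g trA)|apply: (markov_g trB)].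
- exists E%:A; split=> x Sx; rewrite mulr_algl.
    exact: (mtrace_mul_tie relA trA).
  exact: (mtrace_mul_tie relB trB).
- exists z; split=> x; first exact: (mtrace_mul_tie_g relA trA).
  exact: (mtrace_mul_tie_g relB trB).
Qed.

(** By induction on n, with b = x h y in normal form: by cyclicity the trace of
    a x h y is that of (y a x) h, where y a x lives on the strands below h. So h
    may be replaced by its scalar, which leaves a product x y on fewer strands.
    On a single strand, a combination of braids and ties is a scalar. *)
Lemma mtrace_mul_shift n a b : (0 < n <= M)%N ->
  levelB k.+1 a -> subring_gen (bt_gen d psc pg pt n) b -> TB (a * b.2) = TB a * TA b.1.
Proof.
move=> /andP[+ nM] Sa; elim: n nM b => // -[|n] IHn nM b _ Sb.
  have [c [cA cB]] : exists c : K, (forall u, TA (u * b.1) = c *: TA u) /\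
      (forall u, TB (u * b.2) = c *: TB u).
    elim: Sb => {b}[b [c|//|//]||b b' _ [c [cA cB]] _ [c' [cA' cB']]|
                    b b' _ [c [cA cB]] _ [c' [cA' cB']]].
    - exists c; split=> u; rewrite /= -?(scalar_comm relA) -?(scalar_comm relB).
        exact: (markov_scalar trA).
      exact: (markov_scalar trB).
    - by exists 1; split=> u; rewrite mulr1 scale1r.
    - exists (c - c'); split=> u; rewrite /= mulrBr scalerBl.
        by rewrite (mtraceB trA) cA cA'.
      by rewrite (mtraceB trB) cB cB'.
    - exists (c' * c); split=> u; rewrite /= mulrA.
        by rewrite cA' cA scalerA.
      by rewrite cB' cB scalerA.
  by rewrite cB -[b.1]mul1r cA (markov1 trA) -scalerAr mulr1.
elim: {b Sb}(bt_level_span d_gt0 shifted_pair_relations nM Sb) =>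
    [|u v _ Hu _ Hv|x h y Sx Hh Sy].
- by rewrite /= mulr0 (mtrace0 trA) (mtrace0 trB) mulr0.
- by rewrite /= mulrDr (markovD trA) (markovD trB) Hu Hv mulrDr.
have [|l [lA lB]] := mtrace_bt_step _ Hh; first by rewrite nM.
have [Sx1 Sx2] := bt_pair_level Sx; have [Sy1 Sy2] := bt_pair_level Sy.
have Sa' : levelB (k + n.+1) a by apply: yh_level_widen Sa; rewrite addnS ltnS leq_addr.
have := IHn (ltnW nM) (x * y) isT (subring_genM Sx Sy); rewrite /= => IH.
have -> : TB (a * (x * h * y).2) = TB (y.2 * a * x.2 * h.2).
  by rewrite /= !mulrA (markovC trB) !mulrA.
have -> : TA (x * h * y).1 = TA (y.1 * x.1 * h.1).
  by rewrite /= (markovC trA) !mulrA.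
rewrite lB; last by do 2?apply: subring_genM.
rewrite lA; last exact: subring_genM.
rewrite (markovC trA) mulrCA -IH; congr (_ * _).
by rewrite -mulrA (markovC trB) mulrA.
Qed.

End ShiftedPair.

End MarkovTrace.

(** * The presented Yokonuma-Hecke algebras *)

Lemma gen_rel (X : choiceType) (rels : seq (X * bool) -> seq (X * bool) -> Prop) u v :
  rels u v -> word_eval (gen rels) u = word_eval (gen rels) v.
Proof.
have map_id_word w : word_map (id : X -> X) w = w.
  by rewrite /word_map -[RHS]map_id; apply: eq_map => -[].
move=> uv; rewrite !(word_eval_gen rels id) !map_id_word.
exact/presentedP/word_eq_rel.
Qed.

Section Concrete.

Variables (K : fieldType) (d : nat) (q : K).
Hypothesis d_gt0 : (0 < d)%N.
Hypothesis dK : d%:R != 0 :> K.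

Local Notation Y N := (yokonuma_hecke d q N).

Definition yh_scalar N (c : K) : Y N := c *: (1 : Y N).
(** Generators indexed by natural numbers, so that the same index denotes the same
    generator on any number of strands; out of range they are 1. *)
Definition yh_braid N (i : nat) : Y N := oapp (@yh_g K d q N) 1 (insub i).
Definition yh_framing N (j : nat) : Y N := oapp (@yh_t K d q N) 1 (insub j).

Section Fixed.

Variable N : nat.

Lemma yh_of_framedM (a b : mod_framed_braid d N) :
  yh_of_framed q (a * b)%g = yh_of_framed q a * yh_of_framed q b.
Proof. by rewrite /yh_of_framed galgUM rmorphM. Qed.

Lemma yh_of_framed1 : yh_of_framed q (1%g : mod_framed_braid d N) = 1.
Proof. by rewrite /yh_of_framed galgU1 rmorph1. Qed.

Lemma yh_of_framedX (a : mod_framed_braid d N) k :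
  yh_of_framed q (a ^+ k)%g = yh_of_framed q a ^+ k.
Proof.
elim: k => [|k IHk]; first by rewrite expg0 yh_of_framed1.
by rewrite expgS exprS yh_of_framedM IHk.
Qed.

Lemma yh_scalarM c (x : Y N) : yh_scalar N c * x = c *: x.
Proof. by rewrite -[in RHS](mul1r x); symmetry; apply: alg_quot_scaleAl. Qed.

Lemma yh_scalarMr c (x : Y N) : x * yh_scalar N c = c *: x.
Proof. by rewrite -[in RHS](mulr1 x); symmetry; apply: alg_quot_scaleAr. Qed.

Lemma yh_braidE (i : 'I_N.-1) : yh_braid N i = yh_g d q i.
Proof. by rewrite /yh_braid valK. Qed.

Lemma yh_framingE (j : 'I_N) : yh_framing N j = yh_t d q j.
Proof. by rewrite /yh_framing valK. Qed.

Lemma sigma_far (i j : 'I_N.-1) : (i.+1 < j)%N ->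
  (sigma d i * sigma d j = sigma d j * sigma d i)%g.
Proof.
move=> ij; have := gen_rel (mod_framed_braid_rel_framed d
  (framed_braid_rel_braid (braid_rel_far ij))).
by rewrite /= !mulg1.
Qed.

Lemma sigma_near (i j : 'I_N.-1) : j = i.+1 :> nat ->
  (sigma d i * sigma d j * sigma d i = sigma d j * sigma d i * sigma d j)%g.
Proof.
move=> ij; have := gen_rel (mod_framed_braid_rel_framed d
  (framed_braid_rel_braid (braid_rel_near ij))).
by rewrite /= !mulg1 !mulgA.
Qed.

Lemma framing_commute (i j : 'I_N) :
  (framing d i * framing d j = framing d j * framing d i)%g.
Proof.
have := gen_rel (mod_framed_braid_rel_framed d (framed_braid_rel_comm i j)).
by rewrite /= !mulg1.
Qed.

Lemma framing_sigma (i : 'I_N.-1) (j : 'I_N) :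
  (framing d j * sigma d i =
   sigma d i * framing d (tperm (strand_lo i) (strand_hi i) j))%g.
Proof.
have := gen_rel (mod_framed_braid_rel_framed d (framed_braid_rel_act i j)).
by rewrite /= !mulg1.
Qed.

Lemma framing_expd (j : 'I_N) : (framing d j ^+ d = 1)%g.
Proof.
have := gen_rel (mod_framed_braid_rel_pow d j).
have evalX k : word_eval (gen (mod_framed_braid_rel d (n:=N)))
    (nseq k (inr j, true)) = (framing d j ^+ k)%g.
  by elim: k => //= k ->; rewrite expgS.
by rewrite evalX.
Qed.

Lemma alg_pi_framing_idem (i : 'I_N.-1) :
  alg_pi (@yokonuma_hecke_rel K d q N) (framing_idem K d i) =
  tie (@yh_scalar N) d (yh_t d q (strand_lo i)) (yh_t d q (strand_hi i)).
Proof.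
rewrite /framing_idem tieE yh_scalarM linearZ; congr (_ *: _).
have hiV s : (framing d (strand_hi i) ^- s = framing d (strand_hi i) ^+ (d.-1 * s))%g.
  apply/eqP; rewrite eq_sym -(inj_eq (mulIg (framing d (strand_hi i) ^+ s)%g)) mulVg.
  by rewrite -expgnDr -mulSnr prednK // expgnA framing_expd expg1n.
rewrite big_add1 /= big_mkord rmorph_sum /=.
pose F s :=
  yh_of_framed q (framing d (strand_lo i) ^+ s * framing d (strand_hi i) ^- s)%g.
have -> : \sum_(s < d) alg_pi (@yokonuma_hecke_rel K d q N) (galgU K
    (framing d (strand_lo i) ^+ s.+1 * framing d (strand_hi i) ^- s.+1)%g) =
    \sum_(s < d) F s.+1.
  by [].
have -> : \sum_(s < d) F s.+1 = \sum_(s < d) F s.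
  have := big_ord_recl d F : \sum_(s < d.+1) F s = _.
  have := big_ord_recr d F : \sum_(s < d.+1) F s = _.
  move=> -> /=; rewrite addrC.
  have -> : F d = F 0%N by rewrite /F !framing_expd !expg0.
  by move=> /addrI <-.
by apply: eq_bigr => s _; rewrite /F hiV yh_of_framedM !yh_of_framedX.
Qed.

Lemma yh_quadratic (i : 'I_N.-1) :
  yh_g d q i * yh_g d q i = 1 + yh_scalar N (q - q^-1) *
    tie (@yh_scalar N) d (yh_t d q (strand_lo i)) (yh_t d q (strand_hi i)) * yh_g d q i.
Proof.
have : @yokonuma_hecke_rel K d q N (galgU K (sigma d i) ^+ 2 - 1
    - (q - q^-1) *: (framing_idem K d i * galgU K (sigma d i))) by exists i.
move=> /alg_pi_rel /eqP; rewrite !rmorphB rmorph1 rmorphXn /= linearZ rmorphM /=.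
rewrite alg_pi_framing_idem subr_eq0 subr_eq => /eqP.
by rewrite -mulrA yh_scalarM addrC expr2.
Qed.

Lemma yh_relations :
  yokonuma_relations d (q - q^-1) (@yh_scalar N) (yh_braid N) (yh_framing N) N.
Proof.
have gE i (iN : (i.+1 < N)%N) : {i' : 'I_N.-1 | i = i'}.
  have iN' : (i < N.-1)%N by lia.
  by exists (Ordinal iN').
have tE j (jN : (j < N)%N) : {j' : 'I_N | j = j'} by exists (Ordinal jN).
split.
- by move=> c x; rewrite /GRing.comm yh_scalarM yh_scalarMr.
- by rewrite yh_scalarM -scaler_nat scalerA mulVf // scale1r.
- move=> _ _ /tE[i ->] /tE[j ->]; rewrite !yh_framingE /GRing.comm /yh_t.
  by rewrite -!yh_of_framedM framing_commute.
- move=> _ /tE[j ->]; rewrite yh_framingE /yh_t.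
  by rewrite -yh_of_framedX framing_expd yh_of_framed1.
- move=> i j ij jN; have iN : (i.+1 < N)%N by apply: ltn_trans ij (ltnW jN).
  have [i' iE] := gE i iN; have [j' jE] := gE j jN; move: ij; rewrite iE jE => ij.
  by rewrite !yh_braidE /GRing.comm /yh_g -!yh_of_framedM sigma_far.
- move=> i iN; have /gE[j jE] := iN; have /gE[i' iE] := ltnW iN.
  have ij : j = i'.+1 :> nat by rewrite -jE iE.
  by rewrite jE iE !yh_braidE /yh_g -!yh_of_framedM sigma_near.
- move=> _ _ /gE[i ->] /tE[j ->].
  rewrite yh_framingE yh_braidE /yh_t /yh_g -yh_of_framedM framing_sigma.
  rewrite yh_of_framedM; congr (_ * _).
  rewrite -[yh_of_framed _ _]/(yh_t _ _ _) -yh_framingE; congr yh_framing.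
  rewrite /swap_strands; case: tpermP => [->|->|ji jh] /=.
  - by rewrite eqxx.
  - by rewrite gtn_eqF // eqxx.
  - rewrite ifN; last by apply: contra_not_neq ji => ji; apply: val_inj.
    by rewrite ifN //; apply: contra_not_neq jh => jh; apply: val_inj.
- move=> _ /gE[i ->].
  rewrite yh_braidE yh_quadratic.
  by rewrite -(yh_framingE (strand_lo i)) -(yh_framingE (strand_hi i)).
Qed.

End Fixed.
End Concrete.

Section InclusionLevels.

Variables (K : fieldType) (d : nat) (q : K).

Local Notation Y N := (yokonuma_hecke d q N).
Local Notation level N n := (subring_gen (yh_gen
  (@yh_scalar K d q N) (@yh_braid K d q N) (@yh_framing K d q N) n)).

Lemma yh_incl_scalar N c : yh_incl (yh_scalar d q N c) = yh_scalar d q N.+1 c.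
Proof. by rewrite /yh_scalar linearZ rmorph1. Qed.

Lemma yh_incl_braid N i : (i.+1 < N)%N ->
  yh_incl (yh_braid d q N i) = yh_braid d q N.+1 i.
Proof.
move=> iN; have iN' : (i < N.-1)%N by lia.
have -> : i = val (Ordinal iN') by [].
rewrite yh_braidE [LHS]yh_incl_pi galg_mapU /=.
rewrite framed_incl_sigma.
by rewrite (yh_braidE (N := N.+1) d q (widen_ord (leq_pred N) (Ordinal iN'))).
Qed.

Lemma yh_incl_framing N j : (j < N)%N ->
  yh_incl (yh_framing d q N j) = yh_framing d q N.+1 j.
Proof.
move=> jN; have -> : j = val (Ordinal jN) by [].
rewrite yh_framingE [LHS]yh_incl_pi galg_mapU /=.
rewrite framed_incl_framing.
by rewrite (yh_framingE d q (widen_ord (leqnSn N) (Ordinal jN))).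
Qed.

(** The defining rules of the trace concern only the last strand and elements
    coming from the previous algebra; descending along the inclusions makes them
    available for all strands. *)
Lemma yh_level_incl N n x : (n <= N)%N -> level N.+1 n x ->
  exists2 y, level N n y & x = yh_incl y.
Proof.
move=> nN; elim=> {x} [x [c|i ilt|j jlt]||x x' _ [y Sy ->] _ [y' Sy' ->]|
                       x x' _ [y Sy ->] _ [y' Sy' ->]].
- exists (yh_scalar d q N c); first exact/subring_gen_in/yh_gen_sc.
  by rewrite yh_incl_scalar.
- exists (yh_braid d q N i); first exact/subring_gen_in/yh_gen_g.
  by rewrite yh_incl_braid //; apply: leq_trans ilt nN.
- exists (yh_framing d q N j); first exact/subring_gen_in/yh_gen_t.
  by rewrite yh_incl_framing //; apply: leq_trans jlt nN.
- by exists 1; [apply: subring_gen1|rewrite rmorph1].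
- by exists (y - y'); [apply: subring_genB|rewrite rmorphB].
- by exists (y * y'); [apply: subring_genM|rewrite rmorphM].
Qed.

End InclusionLevels.

Section BraidWords.

Local Open Scope quotient_scope.

Variables (K : fieldType) (d : nat) (q : K).
Hypothesis d_gt0 : (0 < d)%N.
Hypothesis dK : d%:R != 0 :> K.

Local Notation Y N := (yokonuma_hecke d q N).
Local Notation sc N := (@yh_scalar K d q N).
Local Notation g N := (@yh_braid K d q N).
Local Notation t N := (@yh_framing K d q N).

Lemma yh_of_braidM N (a b : braid N) :
  yh_of_braid d q (a * b)%g = yh_of_braid d q a * yh_of_braid d q b.
Proof. by rewrite /yh_of_braid gmulfM yh_of_framedM. Qed.

Lemma yh_of_braid1 N : yh_of_braid d q (1%g : braid N) = 1.
Proof. by rewrite /yh_of_braid gmulf1 yh_of_framed1. Qed.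

Lemma yh_of_braid_gen N (i : 'I_N.-1) : yh_of_braid d q (braid_gen i) = g N i.
Proof.
rewrite yh_braidE; congr (yh_of_framed q _).
exact: presented_map_gen.
Qed.

Lemma braid_ind n (P : braid n -> Prop) : P 1%g ->
  (forall i a, P a -> P (braid_gen i * a)%g) ->
  (forall i a, P a -> P ((braid_gen i)^-1 * a)%g) -> forall a, P a.
Proof.
move=> P1 Pg PV; elim/presentedW; elim=> [|[i b] u IHu]; first exact: P1.
have -> : \pi_(presented (@braid_rel n)) ((i, b) :: u) =
    ((if b then braid_gen i else (braid_gen i)^-1) *
     \pi_(presented (@braid_rel n)) u)%g.
  have -> : (if b then braid_gen i else (braid_gen i)^-1)%g
    = \pi_(presented (@braid_rel n)) [:: (i, b)].
    by case: b => //; apply: Defs.pi_inv.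
  by rewrite [RHS]Defs.pi_mul.
by case: b; [apply: Pg|apply: PV].
Qed.

(** Inverses of generators are covered as well, because the quadratic relation
    expresses g_i^-1 by g_i and e_i, in the product algebra too. *)
Lemma braid_shift_bt m N k (kmN : (k + m.+1 <= N)%N)
    (F : UMagmaMorphism.type (braid m.+1) (braid N)) :
  (forall i : 'I_m, exists2 j : 'I_N.-1,
    F (braid_gen (i : 'I_m.+1.-1)) = braid_gen j & j = (k + i)%N :> nat) ->
  forall b : braid m.+1,
  subring_gen (bt_gen d (pair_fun (sc m.+1) (sc N))
    (pair_fun (g m.+1) (fun i => g N (k + i)%N))
    (pair_fun (t m.+1) (fun i => t N (k + i)%N)) m.+1)
    (yh_of_braid d q b, yh_of_braid d q (F b)).
Proof.
move=> Fgen; set S := subring_gen _.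
have rel := shifted_pair_relations (yh_relations q d_gt0 dK m.+1)
  (yh_relations q d_gt0 dK N) kmN.
have pairM a b a' b' : S (a, a') -> S (b, b') -> S (a * b, a' * b').
  exact: subring_genM.
have genE (i : 'I_m) : (yh_of_braid d q (braid_gen (i : 'I_m.+1.-1)),
    yh_of_braid d q (F (braid_gen (i : 'I_m.+1.-1)))) =
    pair_fun (g m.+1) (fun i => g N (k + i)%N) i.
  by have [j -> jE] := Fgen i; rewrite !yh_of_braid_gen jE.
elim/braid_ind => [|i a Sa|i a Sa].
- by rewrite gmulf1 !yh_of_braid1; apply: subring_gen1.
- rewrite gmulfM !yh_of_braidM; apply: pairM Sa.
  by rewrite genE; apply/subring_gen_in/bt_gen_g; rewrite ltnS.
rewrite gmulfM gmulfV !yh_of_braidM; apply: pairM Sa.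
set u := (_, _).
have iN : (i.+1 < m.+1)%N by rewrite ltnS.
suff -> : u = braid_inv d (q - q^-1) (pair_fun (sc m.+1) (sc N))
    (pair_fun (g m.+1) (fun i => g N (k + i)%N))
    (pair_fun (t m.+1) (fun i => t N (k + i)%N)) i by apply: bt_level_braid_inv.
rewrite -[u]mulr1 -(braid_mulV d_gt0 rel iN) mulrA -genE.
rewrite [X in X * _](_ : _ = 1) ?mul1r //.
rewrite /u; congr (_, _); rewrite /= -yh_of_braidM.
  by rewrite mulVg yh_of_braid1.
by rewrite mulVg yh_of_braid1.
Qed.

End BraidWords.

Section Multiplicativity.

Variables (K : fieldType) (d : nat) (q : K) (L : comAlgType K).
Hypothesis d_gt0 : (0 < d)%N.
Hypothesis dK : d%:R != 0 :> K.

Local Notation Y N := (yokonuma_hecke d q N).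
Local Notation level N n := (subring_gen (yh_gen
  (@yh_scalar K d q N) (@yh_braid K d q N) (@yh_framing K d q N) n)).
Local Notation sc N := (@yh_scalar K d q N).
Local Notation g N := (@yh_braid K d q N).
Local Notation t N := (@yh_framing K d q N).

Variables (tau : forall N, Y N -> L) (z : L) (xi : nat -> K) (E : K).
Local Notation T := (@tau _).

Hypothesis tau_linear : forall N c (a b : Y N), T (c *: a + b) = c *: T a + T b.
Hypothesis tauC : forall N (a b : Y N), T (a * b) = T (b * a).
Hypothesis tau1 : forall N, T (1 : Y N) = 1.
Hypothesis tau_incl : forall N (a : Y N), T (yh_incl a) = T a.
Hypothesis tau_incl_g : forall N (a : Y N.+1),
  T (yh_incl a * @yh_g K d q N.+2 ord_max) = z * T a.
Hypothesis tau_incl_t : forall N k (a : Y N), (k < d)%N ->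
  T (yh_incl a * @yh_t K d q N.+1 ord_max ^+ k) = xi k *: T a.
Hypothesis xi_modd : forall k, xi (k %% d) = xi k.
Hypothesis xi_E_system : forall k,
  d%:R^-1 * \sum_(s < d) xi (d.-1 * s) * xi (k + s) = E * xi k.

Let rel N := yh_relations q d_gt0 dK N.

Lemma yh_markov_trace N :
  markov_trace z xi (sc N) (g N) (t N) N (@tau N).
Proof.
split.
- by move=> a b; rewrite -[a]scale1r tau_linear !scale1r.
- move=> c a; rewrite yh_scalarM -[c *: a]addr0 tau_linear -[in RHS](addr0 (c *: _)).
  congr (_ + _); apply: (addrI (T (0 : Y N))).
  by rewrite -{1}[T 0]scale1r -tau_linear scale1r !addr0.
- exact: tauC.
- exact: tau1.
- move=> n; elim: N => // N IHN a; rewrite ltnS => nN /(yh_level_incl nN)[y Sy ->].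
  rewrite tau_incl; move: nN y Sy; rewrite leq_eqVlt => /orP[/eqP <-|nN] y Sy.
    by rewrite -tau_incl_g -yh_braidE.
  by rewrite -yh_incl_braid // -rmorphM tau_incl IHN.
move=> n k; elim: N => // N IHN a; rewrite ltnS => nN /(yh_level_incl nN)[y Sy ->].
rewrite tau_incl; move: nN y Sy; rewrite leq_eqVlt => /orP[/eqP <-|nN] y Sy.
  have tn : t n.+1 n ^+ d = 1 by apply: (framing_pow (rel n.+1)).
  rewrite -(xi_modd k) -(expr_mod k tn).
  rewrite -(tau_incl_t y (ltn_pmod k d_gt0)).
  by rewrite -(yh_framingE d q (@ord_max n)).
by rewrite -yh_incl_framing // -rmorphXn -rmorphM tau_incl IHN.
Qed.

(** The right summand lies in the algebra of braids and ties on the strands n, ...,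
    n + m, and the left one on the strands 0, ..., n, so the trace of the product
    factors. Shifting by 0 strands identifies the trace of the left summand with
    that of the original braid. *)
Lemma trace_braid_sum n m (a : braid n.+1) (b : braid m.+1) :
  T (yh_of_braid d q (braid_sum a b)) =
  T (yh_of_braid d q a) * T (yh_of_braid d q b).
Proof.
pose N := (n + m).+1.
have nN : (0 + n.+1 <= N)%N by rewrite add0n ltnS leq_addr.
have mN : (n + m.+1 <= N)%N by rewrite addnS.
have Sa := @braid_shift_bt K d q d_gt0 dK n N 0 nN (@braid_left n m) _ a.
have Sb := @braid_shift_bt K d q d_gt0 dK m N n mN (@braid_right n m) _ b.
rewrite yh_of_braidM.
have {}Sa := Sa (fun i => ex_intro2 _ _ (lshift m i) (presented_map_gen _ _) erefl).
have {}Sb := Sb (fun i => ex_intro2 _ _ (rshift n i) (presented_map_gen _ _) erefl).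
have mul_shift M k kMN := @mtrace_mul_shift K d (q - q^-1) L z xi E d_gt0 dK xi_E_system
  (Y M) (Y N) _ _ _ _ _ _ M N k (@tau M) (@tau N) (rel M) (rel N)
  (yh_markov_trace M) (yh_markov_trace N) kMN.
have [_ /= Sa2] := bt_pair_level Sa.
have := mul_shift m.+1 n mN m.+1 (yh_of_braid d q (braid_left m a)) _ (leqnn _) Sa2 Sb.
move=> /= ->; congr (_ * _).
have := mul_shift n.+1 0%N nN n.+1 1 _ (leqnn _) (subring_gen1 _) Sa.
by rewrite /= mul1r tau1 mul1r.
Qed.

End Multiplicativity.

(** * The E-system *)

Section ESystem.

Variables (R : realType) (d : nat).
Hypothesis d_gt0 : (0 < d)%N.

Definition cis (x : R) : R[i] := (cos x +i* sin x)%C.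

Lemma cisD x y : cis (x + y) = cis x * cis y.
Proof.
rewrite /cis cosD sinD; apply/eqP; rewrite eq_complex /= eqxx /=.
by rewrite addrC [sin x * _]mulrC.
Qed.

Lemma cisMn x k : cis (x *+ k) = cis x ^+ k.
Proof.
elim: k => [|k IHk]; first by rewrite mulr0n /cis cos0 sin0.
by rewrite mulrS cisD IHk exprS.
Qed.

Definition root1 : R[i] := cis (2 * pi / d%:R).

Let dR_neq0 : d%:R != 0 :> R.
Proof. by rewrite pnatr_eq0 -lt0n. Qed.

Lemma root1X_d : root1 ^+ d = 1.
Proof.
rewrite -cisMn (_ : _ *+ d = pi *+ 2); first by rewrite /cis cos2pi sin2pi.
by rewrite -[LHS]mulr_natr -mulrA mulVf // mulr1 mulr_natl.
Qed.

(** With x = pi k / d in ]0, pi[, the real part of root1 ^+ k is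
    cos (2 x) = 1 - 2 sin^2 x < 1. *)
Lemma root1X_neq1 k : (0 < k < d)%N -> root1 ^+ k != 1.
Proof.
move=> /andP[k_gt0 kd]; apply/eqP => /(congr1 (@complex.Re R)).
rewrite -cisMn /=; set x := pi * k%:R / d%:R : R.
have -> : 2 * pi / d%:R *+ k = x *+ 2.
  rewrite -[LHS]mulr_natr -[RHS]mulr_natl /x !mulrA.
  by rewrite mulrAC.
have dR : 0 < d%:R :> R by rewrite ltr0n.
have sinx : 0 < sin x.
  apply: sin_gt0_pi; rewrite /x; apply/andP; split.
    by rewrite divr_gt0 // mulr_gt0 ?pi_gt0 ?ltr0n.
  by rewrite ltr_pdivrMr // ltr_pM2l ?pi_gt0 // ltr_nat.
have sin2 : 0 < sin x ^+ 2 by rewrite exprn_gt0.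
rewrite cos_mulr2n => cosx; have := cos2Dsin2 x; lra.
Qed.

Lemma sum_root1X k :
  \sum_(s < d) (root1 ^+ k) ^+ s = if (d %| k)%N then d%:R else 0.
Proof.
case: ifP => [/dvdnP[l ->]|dk].
  rewrite (eq_bigr (fun=> 1)) ?sumr_const ?card_ord // => s _.
  by rewrite mulnC exprM root1X_d !expr1n.
have w1 : root1 ^+ k - 1 != 0.
  rewrite (divn_eq k d) exprD mulnC exprM root1X_d expr1n mul1r subr_eq0.
  by apply: root1X_neq1; rewrite ltn_mod d_gt0 andbT lt0n; apply/negbT.
apply: (mulfI w1); rewrite -subrX1 mulr0.
by rewrite -exprM mulnC exprM root1X_d expr1n subrr.
Qed.

Variable D : {set 'I_d}.

Lemma E_solutionE k :
  E_solution R D k = #|D|%:R^-1 * \sum_(m in D) root1 ^+ (k * m).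
Proof.
rewrite /E_solution; congr (_ * _); apply: eq_bigr => m _.
rewrite -cisMn.
have -> // : 2 * pi / d%:R *+ (k * m) = 2 * pi * (k * m)%:R / d%:R :> R.
by rewrite -[LHS]mulr_natr mulrAC.
Qed.

Lemma E_solution_modd k : E_solution R D (k %% d) = E_solution R D k.
Proof.
rewrite !E_solutionE; congr (_ * _); apply: eq_bigr => m _.
rewrite [in RHS](divn_eq k d) mulnDl exprD mulnAC.
by rewrite [(_ * d)%N]mulnC [X in X * _]exprM root1X_d expr1n mul1r.
Qed.

Hypothesis D_neq0 : D != set0.

Let cardD : #|D|%:R != 0 :> R[i].
Proof. by rewrite pnatr_eq0 cards_eq0. Qed.

Lemma E_solution0 : E_solution R D 0 = 1.
Proof.
rewrite E_solutionE (eq_bigr (fun=> 1)) => [|m _]; last by rewrite mul0n.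
by rewrite sumr_const mulVf.
Qed.

(** The values x_k = E_solution k are the means over D of the characters
    k |-> root1 ^+ (k m) of Z/d, and their convolution is computed by the
    orthogonality of these characters: of the pairs (m, m') in D x D, only the
    diagonal survives the summation over s. *)
Lemma E_system k :
  d%:R^-1 * \sum_(s < d) E_solution R D (d.-1 * s) * E_solution R D (k + s)
  = #|D|%:R^-1 * E_solution R D k.
Proof.
set c := #|D|%:R^-1.
have -> : \sum_(s < d) E_solution R D (d.-1 * s) * E_solution R D (k + s) =
    c ^+ 2 * \sum_(m' in D) \sum_(m in D)
      root1 ^+ (k * m') * \sum_(s < d) (root1 ^+ (d.-1 * m + m')) ^+ s.
  rewrite mulr_sumr.
  under [RHS]eq_bigr do rewrite mulr_sumr.
  under [RHS]eq_bigr do under eq_bigr do rewrite mulrA mulr_sumr.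
  under [RHS]eq_bigr do rewrite exchange_big.
  rewrite [RHS]exchange_big; apply: eq_bigr => s _ /=.
  rewrite !E_solutionE -/c mulrACA -expr2 [X in _ * X]mulrC mulr_suml mulr_sumr.
  apply: eq_bigr => m' _; rewrite mulr_sumr mulr_sumr; apply: eq_bigr => m _.
  rewrite -mulrA -exprM -!exprD; congr (_ * _ ^+ _).
  by rewrite !mulnDl [(s * m')%N]mulnC [(d.-1 * s * m)%N]mulnAC addnA addnAC.
have dC : d%:R != 0 :> R[i] by rewrite pnatr_eq0 -lt0n.
rewrite (eq_bigr (fun m' : 'I_d => d%:R * root1 ^+ (k * m'))); last first.
  move=> m' m'D; rewrite (bigD1 m') //= sum_root1X -mulSnr prednK //.
  rewrite dvdn_mulr // mulrC big1 ?addr0 // => m /andP[_ mm'].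
  rewrite sum_root1X ifN ?mulr0 //; apply: contra mm' => /dvdnP[l lE].
  apply/eqP/val_inj; rewrite /= -(modn_small (ltn_ord m)) -(modn_small (ltn_ord m')).
  rewrite -(modnMDl l) -lE addnAC -mulSnr prednK // mulnC.
  by rewrite modnMDl.
by rewrite -mulr_sumr E_solutionE -/c (mulrCA (c ^+ 2)) mulKf // expr2 mulrA.
Qed.

End ESystem.

(** * Specialization of the trace *)

Section Specialization.

Variables (K : fieldType) (d : nat) (q : K).
Variable tr : forall n, {linear yokonuma_hecke d q n -> {mpoly K[d.-1.+1]}}.
Variables (xi : nat -> K) (E : K).

Definition specialize : {mpoly K[d.-1.+1]} -> {poly K} :=
  mmap (@polyC K) (fun j => if unlift ord0 j is Some k then (xi k.+1)%:P else 'X).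

Lemma trace_braid_sum_specialize :
  (0 < d)%N -> d%:R != 0 :> K -> juyumaya_trace tr -> xi 0%N = 1 ->
  (forall k, xi (k %% d) = xi k) ->
  (forall k, d%:R^-1 * \sum_(s < d) xi (d.-1 * s) * xi (k + s) = E * xi k) ->
  forall n m (a : braid n.+1) (b : braid m.+1),
  specialize (tr _ (yh_of_braid d q (braid_sum a b))) =
  specialize (tr _ (yh_of_braid d q a)) * specialize (tr _ (yh_of_braid d q b)).
Proof.
move=> d_gt0 dK trJ xi0 xi_mod xi_E.
have specM p r : specialize (p * r) = specialize p * specialize r by exact: rmorphM.
pose T N (a : yokonuma_hecke d q N) : {poly K} := specialize (tr N a).
have T_linear N c (a b : yokonuma_hecke d q N) :
    T N (c *: a + b) = c *: T N a + T N b.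
  by rewrite /T linearP /specialize raddfD /= mmapZ mul_polyC.
have TC N (a b : yokonuma_hecke d q N) : T N (a * b) = T N (b * a) :=
  f_equal specialize (traceC trJ a b).
have T1 N : T N 1 = 1 by rewrite /T; have := trace1 trJ N => ->; apply: rmorph1.
have T_incl N (a : yokonuma_hecke d q N) : T N.+1 (yh_incl a) = T N a :=
  f_equal specialize (trace_incl trJ a).
have T_g N (a : yokonuma_hecke d q N.+1) :
    T N.+2 (yh_incl a * @yh_g K d q N.+2 ord_max) = 'X * T N.+1 a.
  rewrite /T; have := trace_g trJ a => ->; rewrite specM; congr (_ * _).
  by rewrite /specialize /trace_z mmapX mmap1U unlift_none.
have T_t N k (a : yokonuma_hecke d q N) : (k < d)%N ->
    T N.+1 (yh_incl a * @yh_t K d q N.+1 ord_max ^+ k) = xi k *: T N a.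
  case: k => [|k] kd; first by rewrite expr0 mulr1 T_incl xi0 scale1r.
  have kd' : (k < d.-1)%N by rewrite -ltnS prednK.
  rewrite /T; have := trace_t trJ a (Ordinal kd') => ->.
  rewrite specM -mul_polyC; congr (_ * _).
  by rewrite /specialize /trace_x mmapX mmap1U liftK.
have sumM := @trace_braid_sum K d q {poly K} d_gt0 dK T 'X xi E.
move=> n m a b.
exact: (sumM T_linear TC T1 T_incl T_g T_t xi_mod xi_E n m a b).
Qed.

End Specialization.

Theorem proposition3p4 (R : realType) (d : nat) (d_gt0 : (0 < d)%N)
    (q : R[i]) (q_neq0 : q != 0)
    (tr : forall n, {linear yokonuma_hecke d q n -> {mpoly R[i][d.-1.+1]}})
    (tr_juyumaya : juyumaya_trace tr)
    (D : {set 'I_d}) (D_neq0 : D != set0)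
    (n m : nat) (alpha : braid n.+1) (beta : braid m.+1) :
  specialized_trace D tr (yh_of_braid d q (braid_sum alpha beta))
  = specialized_trace D tr (yh_of_braid d q alpha)
    * specialized_trace D tr (yh_of_braid d q beta).
Proof.
have dC : d%:R != 0 :> R[i] by rewrite Num.Theory.pnatr_eq0 -lt0n.
have := @trace_braid_sum_specialize R[i] d q tr (E_solution R D) #|D|%:R^-1
  d_gt0 dC tr_juyumaya (E_solution0 _ D_neq0) (E_solution_modd _ d_gt0 D)
  (E_system _ d_gt0 D) n m alpha beta.
exact.
Qed.
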